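(* Let $\mu\in(k-1,k]$ with $k\in\mathbb N$, $k\ge 1$, and let $f$ be a real function that is $(k-1)$ times differentiable at the point $\theta\in\mathbb R$. (i) Let $x>\theta$. If $f^{(k-1)}\in \mathrm{AC}([\theta,x])$ and ${}^{C}\!D_{\theta+}^{\mu}f\in \mathrm{BV}([\theta,x])$, then $$f(x)=\sum_{j=0}^{k-1}\frac{f^{(j)}(\theta)}{j!}(x-\theta)^j+\frac{({}^{C}\!D_{\theta+}^{\mu}f)(\theta+)}{\Gamma(\mu+1)}(x-\theta)^{\mu}+\frac{1}{\Gamma(\mu+1)}\int_\theta^x (x-t)^{\mu}\,\mathrm d\{{}^{C}\!D_{\theta+}^{\mu}f(t)\}.$$ (ii) Let $x<\theta$. If $f^{(k-1)}\in \mathrm{AC}([x,\theta])$ and ${}^{C}\!D_{\theta-}^{\mu}f\in \mathrm{BV}([x,\theta])$, then $$f(x)=\sum_{j=0}^{k-1}\frac{f^{(j)}(\theta)}{j!}(x-\theta)^j+\frac{({}^{C}\!D_{\theta-}^{\mu}f)(\theta-)}{\Gamma(\mu+1)}(\theta-x)^{\mu}-\frac{1}{\Gamma(\mu+1)}\int_x^\theta (t-x)^{\mu}\,\mathrm d\{{}^{C}\!D_{\theta-}^{\mu}f(t)\}.$$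
   Context: $\mathrm{AC}([a,b])$ and $\mathrm{BV}([a,b])$ denote the absolutely continuous functions and the functions of bounded variation on $[a,b]$. Fractional integrals: for $\rho>0$ and $f\in L^1(a,b)$, $(I_{a+}^\rho f)(x)=\frac1{\Gamma(\rho)}\int_a^x\frac{f(y)}{(x-y)^{1-\rho}}\,\mathrm dy$ and $(I_{b-}^\rho f)(x)=\frac1{\Gamma(\rho)}\int_x^b\frac{f(y)}{(y-x)^{1-\rho}}\,\mathrm dy$; $I^0_{a+}$ and $I^0_{b-}$ are the identity. Caputo derivatives: for $\mu\in(k-1,k]$, $({}^{C}\!D_{a+}^{\mu}f)(x)=(I_{a+}^{k-\mu}f^{(k)})(x)$ and $({}^{C}\!D_{b-}^{\mu}f)(x)=(-1)^k(I_{b-}^{k-\mu}f^{(k)})(x)$. These are defined almost everywhere; saying that such a function is in BV means it agrees a.e. with a BV function, with which it is then identified. $h(c\pm)$ denote one-sided limits. For $h\in\mathrm{BV}([c,d])$ and $\varphi$ continuous, $\int_c^d\varphi\,\mathrm dh$ is the Riemann–Stieltjes integral taken without jump contributions at the endpoints, i.e. with $h(c),h(d)$ understood as $h(c+),h(d-)$ (integral over the open interval $(c,d)$). *)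

(* Defs.v *)
From HB Require Import structures.
From mathcomp Require Export all_boot all_order all_algebra.
From mathcomp Require Export all_classical all_reals all_analysis.

Set Implicit Arguments.
Unset Strict Implicit.
Unset Printing Implicit Defensive.

Import Order.TTheory GRing.Theory Num.Theory.
Import numFieldNormedType.Exports.

Local Open Scope classical_set_scope.
Local Open Scope ring_scope.

Section definitions.
Context {R : realType}.
Implicit Types (a b c d x y t rho mu : R) (f g h phi : R -> R) (A : set R).

Local Notation leb := (@lebesgue_measure R).

Definition Gamma x : R :=
  \int[leb]_(t in `]0, +oo[) (t `^ (x - 1) * expR (- t)).

Fixpoint n_derivable_at n f a : Prop :=
  if n is m.+1 then
    (\forall y \near a, n_derivable_at m f y) /\ derivable (f^`(m)%classic) a 1
  else True.

(* Derivatives relative to a set: on `[a, b] they are one-sided at a and b,   *)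
(* so that the values of f outside of `[a, b] play no role.                   *)
Definition derivable1_on A f x : Prop :=
  cvg ((f y - f x) / (y - x) @[y --> within A x^']).

Definition derive1_on A f x : R :=
  lim ((f y - f x) / (y - x) @[y --> within A x^']).

Definition derive1n_on A n f : R -> R := iter n (derive1_on A) f.

Definition n_derivable_on A n f : Prop :=
  forall j, (j < n)%N -> forall y, A y -> derivable1_on A (derive1n_on A j f) y.

Definition abs_continuous a b f : Prop :=
  forall e, 0 < e -> exists2 d, 0 < d &
    forall (n : nat) (u v : 'I_n -> R),
      (forall i, a <= u i /\ u i < v i /\ v i <= b) ->
      (forall i j, i != j -> v i <= u j \/ v j <= u i) ->
      \sum_(i < n) (v i - u i) < d ->
      \sum_(i < n) `|f (v i) - f (u i)| < e.

(* "the n-th derivative of f exists on [a, b] and belongs to AC([a, b])"      *)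
Definition derive_AC a b n f : Prop :=
  n_derivable_on `[a, b] n f /\ abs_continuous a b (derive1n_on `[a, b] n f).

Definition fracint_left rho a f x : R :=
  if rho == 0 then f x
  else (Gamma rho)^-1 * \int[leb]_(y in `]a, x[) (f y / (x - y) `^ (1 - rho)).

Definition fracint_right rho b f x : R :=
  if rho == 0 then f x
  else (Gamma rho)^-1 * \int[leb]_(y in `]x, b[) (f y / (y - x) `^ (1 - rho)).

(* k is meant to be the integer such that k - 1 < mu <= k.  Since f^`(k) is   *)
(* only needed almost everywhere, the unrestricted derivative is used: it     *)
(* coincides with the relative one in the interior of an interval.            *)
Definition caputo_left k mu a f x : R :=
  fracint_left (k%:R - mu) a (f^`(k)%classic) x.

Definition caputo_right k mu b f x : R :=
  (- 1) ^+ k * fracint_right (k%:R - mu) b (f^`(k)%classic) x.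

(* The subdivision a = t_0 < ... < t_n = b is encoded by s = [t_1; ...; t_n]. *)
Definition subdiv a b (s : seq R) (i : nat) : R := nth b (a :: s) i.

Definition RS_sum a b phi g (s : seq R) (xi : nat -> R) : R :=
  \sum_(0 <= i < size s)
    phi (xi i) * (g (subdiv a b s i.+1) - g (subdiv a b s i)).

Definition is_RS_integral a b phi g (I : R) : Prop :=
  forall e, 0 < e -> exists2 d, 0 < d &
    forall (s : seq R) (xi : nat -> R), itv_partition a b s ->
      (forall i, (i < size s)%N ->
         subdiv a b s i.+1 - subdiv a b s i < d /\
         subdiv a b s i <= xi i <= subdiv a b s i.+1) ->
      `|RS_sum a b phi g s xi - I| < e.

(* The default value 0 plays no role when g is BV and phi is continuous on    *)
(* [a, b] with a < b: the limit then exists and is unique.                    *)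
Definition RS_integral a b phi g : R := xget 0 (is_RS_integral a b phi g).

Definition no_end_jumps a b h t : R :=
  if t == a then lim (h @ a^'+) else if t == b then lim (h @ b^'-) else h t.

Definition RS_integral_open a b phi h : R :=
  RS_integral a b phi (no_end_jumps a b h).

End definitions.

(* Main.v *)
Require Import Defs.
From HB Require Import structures.
From mathcomp Require Import measurable_realfun.
From mathcomp Require Import ring lra.

Set Implicit Arguments.
Unset Strict Implicit.
Unset Printing Implicit Defensive.

Import Order.TTheory GRing.Theory Num.Theory.
Import numFieldNormedType.Exports.

Local Open Scope classical_set_scope.
Local Open Scope ring_scope.

(** With [g] the k-th derivative, Taylor's formula with integral remainder reads
    f(x) = T(x) + (I^k g)(x), and I^k = I^mu I^(k-mu) turns the remainder into
    I^mu of the Caputo derivative h, that is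
    1/Gamma(mu) * \int (x - t)^(mu-1) h(t) dt.  As (x - t)^mu has derivative
    -mu (x - t)^(mu-1), a Riemann-Stieltjes integration by parts gives the
    boundary term at theta and the integral against dh.
    - Taylor's formula follows from Lebesgue's fundamental theorem of calculus
      applied to the Taylor sum of f as a function of the expansion point, an
      absolutely continuous function.  The fundamental theorem itself is obtained
      from Radon-Nikodym: the Stieltjes measure of an absolutely continuous
      monotone function is dominated by the Lebesgue measure, and the total
      variation reduces the general case to the monotone one.
    - The semigroup law is Fubini's theorem combined with
      Beta(p, q) = Gamma(p) Gamma(q) / Gamma(p + q). *)

(** * Absolutely continuous functions *)

(** For [mu < 1] the weight [(x - t) ^ (mu - 1)] is unbounded near [x], so the power [(x - t) ^ mu]
    is not C1 up to the endpoint and the classical integration by parts does not apply. In that step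
    the power enters only as the integral of a weight of constant sign and through its uniform
    continuity. It vanishes at [x], so of the two boundary terms only the limit of [h] at [theta]
    survives; the factor [mu] of its derivative turns [Gamma mu] into [Gamma (mu + 1)]. Two notions
    of derivative meet. On the segment the derivatives are relative to it, while the statement has
    the classical ones at [theta]; differentiability at [theta] identifies them. At the other end
    the Taylor sum collapses to [f x]. The k-th derivative and the Caputo derivative are known only
    almost everywhere, so they occur only under integrals, where the first is traded for an
    integrable density [g]. *)

Section abs_continuous_theory.
Context {R : realType}.
Implicit Types (a b c x y : R) (F G : R -> R).

(** Degenerate intervals contribute zero to both sums; dropping them and enumerating the others
    returns to the definition. Later families are indexed by pairs, or contain intervals that
    collapse under clamping. *)
Lemma abs_continuous_finType a b F : abs_continuous a b F ->
  forall e : R, 0 < e -> exists2 d : R, 0 < d &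
    forall (I : finType) (P : pred I) (u v : I -> R),
      (forall i, P i -> a <= u i <= v i /\ v i <= b) ->
      (forall i j, P i -> P j -> i != j -> v i <= u j \/ v j <= u i) ->
      \sum_(i | P i) (v i - u i) < d ->
      \sum_(i | P i) `|F (v i) - F (u i)| < e.
Proof.
move=> acF e /acF[d d0 h]; exists d => // I P u v uv dis sd.
pose A := [pred i | P i && (u i < v i)].
have key (G : I -> R) : (forall i, P i -> u i = v i -> G i = 0) ->
    \sum_(i | P i) G i = \sum_(j < #|A|) G (enum_val j).
  move=> G0; rewrite -big_enum_val [LHS](bigID (fun i => u i < v i))/= addrC [X in X + _]big1 ?add0r//.
  by move=> i /andP[Pi]; rewrite -leNgt => vu; apply: G0 => //;
    have [/andP[_ ?] _] := uv _ Pi; apply/eqP; rewrite eq_le; apply/andP.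
rewrite key; last by move=> i _ ->; rewrite subrr normr0.
apply: (h _ (fun j => u (enum_val j)) (fun j => v (enum_val j))).
- move=> i; have /andP[Pi uvi] := enum_valP i.
  by have [/andP[-> _] ->] := uv _ Pi.
- move=> i j ij; have /andP[Pi _] := enum_valP i; have /andP[Pj _] := enum_valP j.
  by apply: dis => //; apply: contra ij => /eqP/enum_val_inj ->.
- by rewrite -(key (fun i => v i - u i))// => i _ ->; rewrite subrr.
Qed.

Lemma subdiv_nondecreasing a b (s : seq R) : itv_partition a b s ->
  {in [pred i | (i <= size s)%N] &, {homo subdiv a b s : i j / (i <= j)%N >-> i <= j}}.
Proof.
move=> [ps _] i j; rewrite !inE => si sj ij; rewrite /subdiv.
have srt : sorted <=%R (a :: s) by apply: (sub_path _ ps) => x y; exact: ltW.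
by apply: (sorted_leq_nth le_trans lexx _ srt) => //; rewrite inE.
Qed.

Lemma subdiv_itv a b s i : itv_partition a b s -> (i <= size s)%N ->
  a <= subdiv a b s i <= b.
Proof.
by move=> ps si; rewrite itv_partition_nth_ge//= itv_partition_nth_le.
Qed.

Lemma subdiv0 a b s : subdiv a b s 0 = a.
Proof. by []. Qed.

Lemma subdiv_size a b s : itv_partition a b s -> subdiv a b s (size s) = b.
Proof. by move=> ps; exact: itv_partition_nth_size. Qed.

Lemma sum_subdiv (A : zmodType) a b s (G : R -> A) : itv_partition a b s ->
  \sum_(0 <= i < size s) (G (subdiv a b s i.+1) - G (subdiv a b s i)) = G b - G a.
Proof.
by move=> ps; rewrite (telescope_sumr (fun i => G (subdiv a b s i)))// subdiv_size// subdiv0.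
Qed.

(** The cells of all the subdivisions, indexed by dependent pairs (interval, cell), again form a
    nonoverlapping family, and its total length is unchanged. *)
Lemma abs_continuous_variations a b F : abs_continuous a b F ->
  forall e : R, 0 < e -> exists2 d : R, 0 < d &
    forall (I : finType) (P : pred I) (u v : I -> R) (s : I -> seq R),
      (forall i, P i -> a <= u i <= v i /\ v i <= b) ->
      (forall i j, P i -> P j -> i != j -> v i <= u j \/ v j <= u i) ->
      (forall i, P i -> itv_partition (u i) (v i) (s i)) ->
      \sum_(i | P i) (v i - u i) < d ->
      \sum_(i | P i) variation (u i) (v i) F (s i) < e.
Proof.
move=> acF e /(abs_continuous_finType acF)[d d0 h]; exists d => // I P u v s uv dis sP sd.
pose t i := subdiv (u i) (v i) (s i).
have E (G : I -> nat -> R) : \sum_(i | P i) \sum_(0 <= j < size (s i)) G i j =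
    \sum_(k : {i : I & 'I_(size (s i))} | P (tag k)) G (tag k) (tagged k).
  under eq_bigr do rewrite big_mkord.
  by rewrite (sig_big_dep _ (fun=> xpredT) (fun i (j : 'I_(size (s i))) => G i j))/=;
    apply: eq_bigl => k; rewrite andbT.
rewrite (E (fun i j => `|F (t i j.+1) - F (t i j)|)).
apply: (h _ _ (fun k : {i : I & 'I_(size (s i))} => t (tag k) (tagged k))
              (fun k => t (tag k) (tagged k).+1)).
- move=> [i j] /= Pi; have [/andP[au _] vb] := uv _ Pi.
  have /andP[h1 h2] := subdiv_itv (sP _ Pi) (ltnW (ltn_ord j)).
  have /andP[h3 h4] := subdiv_itv (sP _ Pi) (ltn_ord j).
  rewrite (le_trans au h1) (le_trans h4 vb)/=; split => //.
  by apply: subdiv_nondecreasing; rewrite ?inE//=; [exact: sP|exact: ltnW].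
- move=> [i j] [i' j'] /= Pi Pi' neq.
  have [ii'|ii'] := eqVneq i i'; last first.
    have /andP[_ h4] := subdiv_itv (sP _ Pi) (ltn_ord j).
    have /andP[h3 _] := subdiv_itv (sP _ Pi) (ltnW (ltn_ord j)).
    have /andP[h1 _] := subdiv_itv (sP _ Pi') (ltnW (ltn_ord j')).
    have /andP[_ h2] := subdiv_itv (sP _ Pi') (ltn_ord j').
    by have [vu|vu] := dis _ _ Pi Pi' ii'; [left|right];
      rewrite (le_trans _ (le_trans vu _)).
  move: ii' j' Pi' neq => <- {i'} j' _ neq.
  have {neq}: (j : nat) != j' by apply: contra neq => /eqP/ord_inj ->.
  rewrite neq_ltn => /orP[jj'|jj']; [left|right];
    apply: subdiv_nondecreasing; rewrite ?inE//=; try exact: sP; exact: ltnW.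
- rewrite -(E (fun i j => t i j.+1 - t i j)).
  rewrite (eq_bigr (fun i => v i - u i))// => i Pi.
  exact: (sum_subdiv (fun x => x) (sP _ Pi)).
Qed.

Lemma abs_continuous_bounded_variation a b F : a <= b ->
  abs_continuous a b F -> bounded_variation a b F.
Proof.
move=> ab acF; apply/(bounded_variationP _ ab).
have [d d0 h] := abs_continuous_variations acF ltr01.
have small x y : a <= x <= y -> y <= b -> y - x < d ->
    total_variation x y F \is a fin_num.
  move=> axy yb yx; have /andP[_ xy] := axy.
  apply/(bounded_variationP _ xy); exists 1 => _ [s sP <-]; apply: ltW.
  have := h unit xpredT (fun=> x) (fun=> y) (fun=> s).
  rewrite !(big_pred1 tt); [|by case..].
  by apply => //; case; case.
(* The variation is at most 1 on intervals shorter than [d]. Steps of length [d / 2] keep every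
   added piece strictly below that threshold. *)
have key n x : a <= x <= b -> x - a < n%:R * (d / 2) -> total_variation a x F \is a fin_num.
  elim: n x => [x /andP[ax _]|n IH x axb xa].
    by rewrite mul0r subr_lt0 ltNge ax.
  have /andP[ax xb] := axb.
  have [xad|xad] := ltP (x - a) d; first by apply: small => //; rewrite lexx.
  have {}IH : total_variation a (x - d / 2) F \is a fin_num.
    by apply: IH; [apply/andP; split; lra|move: xa; rewrite -natr1; lra].
  have axd : a <= x - d / 2 by lra.
  rewrite (@total_variationD _ a x (x - d / 2))//; last by lra.
  by rewrite fin_numD IH/= small//; [apply/andP; split; lra|lra].
apply: (key (Num.trunc ((b - a) / (d / 2))).+1); first by rewrite ab lexx.
by rewrite -ltr_pdivrMr ?truncnS_gt// divr_gt0.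
Qed.

Definition vtot a F x : R := fine (total_variation a x F).

Lemma vtotB a b F x y : bounded_variation a b F -> a <= x <= y -> y <= b ->
  (vtot a F y - vtot a F x)%:E = total_variation x y F.
Proof.
move=> bv /andP[ax xy] yb.
have fax : total_variation a x F \is a fin_num.
  by apply/(bounded_variationP _ ax); apply: bounded_variationl bv => //; exact: le_trans yb.
have fay : total_variation a y F \is a fin_num.
  by apply/bounded_variationP; [exact: le_trans xy|apply: bounded_variationl bv => //; exact: le_trans xy].
rewrite EFinB /vtot !fineK// (@total_variationD _ a y x)// addeC addeA.
by rewrite [X in (X + _)%E]addeC subee// add0e.
Qed.

Lemma vtot_dist a b F x y : bounded_variation a b F -> a <= x <= y -> y <= b ->
  `|F y - F x| <= vtot a F y - vtot a F x.
Proof.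
move=> bv axy yb; rewrite -lee_fin (vtotB bv axy yb).
by apply: total_variation_ge; case/andP: axy.
Qed.

(** On each interval a subdivision nearly attains the total variation, and absolute continuity of
    [F] controls the sum of these variations. *)
Lemma abs_continuous_vtot a b F : a <= b ->
  abs_continuous a b F -> abs_continuous a b (vtot a F).
Proof.
move=> ab acF e e0; have bv := abs_continuous_bounded_variation ab acF.
have e20 : 0 < e / 2 by rewrite divr_gt0.
have [d d0 h] := abs_continuous_variations acF e20; exists d => // n u v uv dis sd.
have axy i : a <= u i <= v i by have [-> [/ltW -> _]] := uv i.
have vb i : v i <= b by have [_ []] := uv i.
(* Each of the [n] suprema is missed by less than this, hence by at most [e / 2] in all; [n.+1] also
   covers the empty family. *)
have n0 : 0 < e / 2 / n.+1%:R by rewrite divr_gt0.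
have /choice[s sP] : forall i, exists s, itv_partition (u i) (v i) s /\
    vtot a F (v i) - vtot a F (u i) - e / 2 / n.+1%:R < variation (u i) (v i) F s.
  move=> i; have E := vtotB bv (axy i) (vb i).
  have : ((vtot a F (v i) - vtot a F (u i) - e / 2 / n.+1%:R)%:E <
      total_variation (u i) (v i) F)%E by rewrite -E lte_fin ltrBlDr ltrDl.
  by move=> /ereal_sup_gt[_ [_ [s sP <-] <-]]; rewrite lte_fin => ?; exists s.
rewrite (@le_lt_trans _ _ (\sum_(i < n) (variation (u i) (v i) F (s i) + e / 2 / n.+1%:R)))//.
  apply: ler_sum => i _; rewrite -lerBlDr ltW//.
  rewrite ger0_norm; first by have [] := sP i.
  by rewrite (le_trans _ (vtot_dist bv (axy i) (vb i))).
rewrite big_split/= sumr_const card_ord [ltRHS](splitr e) ltr_leD//.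
  apply: (h _ _ u v s) => //; [by move=> i j _ _; exact: dis|].
  by move=> i _; have [] := sP i.
rewrite -[leLHS]mulr_natl mulrCA ler_piMr//; first exact: ltW.
by rewrite ler_pdivrMr// mul1r ler_nat.
Qed.

Lemma abs_continuousD a b F G : abs_continuous a b F -> abs_continuous a b G ->
  abs_continuous a b (F \+ G).
Proof.
move=> acF acG e e0; have e20 : 0 < e / 2 by rewrite divr_gt0.
have [d d0 h] := acF _ e20; have [d' d'0 h'] := acG _ e20.
exists (Num.min d d') => [|n u v uv dis]; rewrite lt_min ?d0//.
move=> /andP[s1 s2]; have := h _ _ _ uv dis s1; have := h' _ _ _ uv dis s2 => hG hF.
rewrite (splitr e) (le_lt_trans _ (ltrD hF hG))// -big_split ler_sum//= => i _.
by rewrite opprD addrACA ler_normD.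
Qed.

Lemma abs_continuousN a b F : abs_continuous a b F -> abs_continuous a b (\- F).
Proof.
move=> acF e /acF[d d0 h]; exists d => // n u v uv dis sd.
rewrite (eq_bigr (fun i => `|F (v i) - F (u i)|)) ?h// => i _.
by rewrite -opprD normrN.
Qed.

Lemma eq_abs_continuous a b F G : {in `[a, b], F =1 G} ->
  abs_continuous a b F -> abs_continuous a b G.
Proof.
move=> FG acF e /acF[d d0 h]; exists d => // n u v uv dis sd.
rewrite (eq_bigr (fun i => `|F (v i) - F (u i)|)) ?h// => i _.
have [au [/ltW uvi vb]] := uv i.
by rewrite !FG// in_itv/= ?vb ?au ?andbT/=; [exact: (le_trans uvi)|exact: (le_trans au)].
Qed.

Lemma lipschitz_abs_continuous a b F (M : R) :
  (forall x y, a <= x <= y -> y <= b -> `|F y - F x| <= M * (y - x)) ->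
  abs_continuous a b F.
Proof.
move=> lip e e0; have M1 : 0 < `|M| + 1 by rewrite ltr_wpDl.
exists (e / (`|M| + 1)) => [|n u v uv _]; rewrite ?divr_gt0// ltr_pdivlMr//.
apply: le_lt_trans; rewrite mulr_suml ler_sum// => i _.
have [au [/ltW uvi vb]] := uv i.
rewrite (le_trans (lip _ _ _ _)) ?au// mulrC ler_wpM2l ?subr_ge0//.
by rewrite (le_trans (ler_norm M))// lerDl.
Qed.

Lemma abs_continuous_bounded a b F : a <= b -> abs_continuous a b F ->
  exists2 M : R, 0 < M & forall x, a <= x <= b -> `|F x| <= M.
Proof.
move=> ab /(abs_continuous_bounded_variation ab) bv.
(* The distance from [F a] is at most the total variation; adding 1 makes the bound positive. *)
exists (`|F a| + `|vtot a F b| + 1) => [|x /andP[ax xb]]; first by rewrite ltr_wpDl// addr_ge0.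
have := vtot_dist bv (x := a) (y := x); rewrite lexx ax => /(_ isT xb).
have := vtot_dist bv (x := x) (y := b); rewrite ax xb lexx => /(_ isT isT).
rewrite (_ : vtot a F a = 0) ?subr0; last by rewrite /vtot total_variationxx.
move=> h1 h2; rewrite -{1}(subrK (F a) (F x)) (le_trans (ler_normD _ _))// addrC -addrA lerD2l.
rewrite (le_trans h2)// (le_trans _ (_ : vtot a F b <= _))//.
  by rewrite -subr_ge0 (le_trans _ h1).
by rewrite (le_trans (ler_norm _))// lerDl.
Qed.

Lemma abs_continuousM a b F G : abs_continuous a b F -> abs_continuous a b G ->
  a <= b -> abs_continuous a b (F \* G).
Proof.
move=> acF acG ab.
have bnd := fun H => @abs_continuous_bounded a b H ab.
have [M M0 hM] := bnd _ acF; have [N N0 hN] := bnd _ acG.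
move=> e e0; have e1 : 0 < e / (2 * N) by rewrite divr_gt0// mulr_gt0.
have e2 : 0 < e / (2 * M) by rewrite divr_gt0// mulr_gt0.
have [d d0 h] := acF _ e1; have [d' d'0 h'] := acG _ e2.
exists (Num.min d d') => [|n u v uv dis]; rewrite lt_min ?d0//.
move=> /andP[s1 s2]; have := h _ _ _ uv dis s1; have := h' _ _ _ uv dis s2.
rewrite !ltr_pdivlMr ?mulr_gt0// => hG hF.
apply: (@le_lt_trans _ _ ((\sum_(i < n) `|F (v i) - F (u i)|) * N +
    (\sum_(i < n) `|G (v i) - G (u i)|) * M)); last by nra.
rewrite !mulr_suml -big_split ler_sum//= => i _.
have [au [/ltW uvi vb]] := uv i.
have -> : F (v i) * G (v i) - F (u i) * G (u i) =
  (F (v i) - F (u i)) * G (v i) + (G (v i) - G (u i)) * F (u i) by ring.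
rewrite (le_trans (ler_normD _ _))// !normrM lerD// ler_wpM2l//.
  by rewrite hN// vb (le_trans au).
by rewrite hM// au (le_trans uvi).
Qed.

End abs_continuous_theory.

(** * Lebesgue's fundamental theorem of calculus *)

Section monotone_density.
Context {R : realType}.
Implicit Types (a b x y u v : R) (F : R -> R).
Local Notation leb := (@lebesgue_measure R).

(** The projection onto the segment. Composing with it extends a function by its endpoint values to
    the whole line, where Stieltjes measures and measurability are stated. *)
Definition clamp a b x := Num.max a (Num.min b x).

Lemma clamp_itv a b x : a <= b -> a <= clamp a b x <= b.
Proof. by move=> ab; rewrite /clamp le_max lexx/= ge_max ab ge_min lexx. Qed.

Lemma clamp_id a b x : a <= x <= b -> clamp a b x = x.
Proof. by move=> /andP[ax xb]; rewrite /clamp min_r// max_r. Qed.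

Lemma clamp_le a b x y : x <= y -> clamp a b x <= clamp a b y.
Proof.
move=> xy; rewrite /clamp ge_max le_max lexx/= le_max; apply/orP; right.
by rewrite le_min ge_min lexx/= ge_min xy orbT.
Qed.

Lemma clampB_le a b x y : x <= y -> clamp a b y - clamp a b x <= y - x.
Proof.
move=> xy; rewrite lerBlDr {1}/clamp ge_max; apply/andP; split.
  have : a <= clamp a b x by rewrite /clamp le_max lexx.
  lra.
have : Num.min b x <= clamp a b x by rewrite /clamp le_max lexx orbT.
have : Num.min b y <= b by rewrite ge_min lexx.
have : Num.min b y <= y by rewrite ge_min lexx orbT.
by case: (leP b x) => ? ? ? ?; lra.
Qed.

(** Clamping preserves order and does not increase lengths, so the estimate extends to intervals
    lying anywhere on the line. *)
Lemma abs_continuous_clamp a b F : a <= b -> abs_continuous a b F ->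
  forall e : R, 0 < e -> exists2 d : R, 0 < d &
    forall (I : finType) (P : pred I) (u v : I -> R),
      (forall i, P i -> u i <= v i) ->
      (forall i j, P i -> P j -> i != j -> v i <= u j \/ v j <= u i) ->
      \sum_(i | P i) (v i - u i) < d ->
      \sum_(i | P i) `|F (clamp a b (v i)) - F (clamp a b (u i))| < e.
Proof.
move=> ab acF e /(abs_continuous_finType acF)[d d0 h]; exists d => // I P u v uv dis sd.
apply: (h _ _ (clamp a b \o u) (clamp a b \o v)) => /=.
- by move=> i Pi; have /andP[-> _] := clamp_itv (u i) ab;
    have /andP[_ ->] := clamp_itv (v i) ab; rewrite clamp_le// uv.
- by move=> i j Pi Pj ij; have [] := dis _ _ Pi Pj ij => vu; [left|right]; exact: clamp_le.
- by rewrite (le_lt_trans _ sd)// ler_sum// => i Pi; rewrite clampB_le// uv.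
Qed.

Lemma abs_continuous_clamp_continuous a b F : a <= b -> abs_continuous a b F ->
  continuous (F \o clamp a b).
Proof.
move=> ab acF x; apply/cvgrPdist_lt => e e0.
have [d d0 h] := abs_continuous_clamp ab acF e0.
have key u v : u <= v -> v - u < d -> `|F (clamp a b v) - F (clamp a b u)| < e.
  move=> uv vu; have := h unit xpredT (fun=> u) (fun=> v).
  by rewrite !(big_pred1 tt); [apply => //; case; case|case..].
near=> y => /=.
have yd : `|x - y| < d by near: y; apply: cvgr_dist_lt.
have [xy|/ltW yx] := leP x y.
  by rewrite distrC key// (le_lt_trans (ler_norm _))// distrC.
by rewrite key// (le_lt_trans (ler_norm _)).
Unshelve. all: by end_near. Qed.

(** Finite measure excludes the unbounded intervals; openness makes a bounded one equal to its
    interior. *)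
Lemma open_interval_finite_measure (U : set R) : open U -> is_interval U ->
  (leb U < +oo)%E -> exists uv : R * R, U = `]uv.1, uv.2[%classic.
Proof.
move=> oU /is_intervalP UE.
have nE : exists uv : R * R, (set0 : set R) = `]uv.1, uv.2[%classic.
  by exists (0, 0); rewrite set_itv_ge// bnd_simp ltxx.
move: UE; case: (Rhull U) => [[c u|[]] [d v|[]]] UE; rewrite UE.
- move=> _; exists (u, v) => /=.
  by rewrite -UE; move/interior_id : oU => <-; rewrite UE interior_itv_bnd.
- by rewrite set_itvE.
- by rewrite lebesgue_measure_itv/= ltry.
- by rewrite lebesgue_measure_itv/= ltNyr.
- by rewrite set_itvE.
- by rewrite lebesgue_measure_itv.
- by rewrite set_itvE.
- by rewrite set_itvE.
- by rewrite set_itvE.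
Qed.

Lemma disjoint_itvoo u v u' v' : u < v -> u' < v' ->
  `]u, v[%classic `&` `]u', v'[%classic = set0 -> v <= u' \/ v' <= u.
Proof.
move=> uv uv' dis; have [vu|uv1] := leP v u'; [by left|].
have [vu|uv2] := leP v' u; [by right|]; exfalso.
(* If the intervals overlapped, the midpoint of these two numbers would lie in both. *)
have lt : Num.max u u' < Num.min v v' by rewrite gt_max !lt_min uv uv1 uv2 uv'.
suff : (set0 : set R) ((Num.max u u' + Num.min v v') / 2) by [].
rewrite -dis; split => /=; rewrite in_itv/=.
  have := midf_lt lt; have : u <= Num.max u u' by rewrite le_max lexx.
  have : Num.min v v' <= v by rewrite ge_min lexx.
  by move=> ? ? [? ?]; apply/andP; split; lra.
have := midf_lt lt; have : u' <= Num.max u u' by rewrite le_max lexx orbT.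
have : Num.min v v' <= v' by rewrite ge_min lexx orbT.
by move=> ? ? [? ?]; apply/andP; split; lra.
Qed.

Lemma stieltjes_itvoc (W : cumulative R R) u v : u <= v ->
  lebesgue_stieltjes_measure W `]u, v]%classic = (W v - W u)%:E.
Proof.
move=> uv; rewrite /lebesgue_stieltjes_measure /measure_extension.
by rewrite measurable_mu_extE/= ?wlength_itv_bnd//; exact: is_ocitv.
Qed.

(** A null set lies in an open set of Lebesgue measure below [d]. This set is a countable disjoint
    union of open intervals, whose Stieltjes masses are increments of [F]; absolute continuity
    bounds their sum by [e]. *)
Lemma abs_continuous_stieltjes_dominates a b F (W : cumulative R R) : a <= b ->
  abs_continuous a b F -> (W : R -> R) = F \o clamp a b ->
  lebesgue_stieltjes_measure W `<< leb.
Proof.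
move=> ab acF WE.
pose nu : {measure set (measurableTypeR R) -> \bar R} := lebesgue_stieltjes_measure W.
apply/null_content_dominatesP => A mA A0; apply/eqP; rewrite eq_le measure_ge0 andbT.
apply/lee_addgt0Pr => e e0; rewrite add0e.
have [d d0 h] := abs_continuous_clamp ab acF e0.
have [U [oU AU]] : exists U : set R, [/\ open U , A `<=` U & (leb U < d%:E)%E].
  have [||U [oU AU Ud]] := @lebesgue_regularity_outer R A d mA; rewrite ?A0 ?ltry//.
  exists U; split => //; have mU := open_measurable oU.
  rewrite -(setDUK AU) (le_lt_trans (measureU2 _ _ _))//; first exact: measurableD.
  by rewrite [X in (X + _)%E](_ : _ = 0%E)// add0e.
move=> Ud; have mU := open_measurable oU.
have -> // : (nu A <= e%:E)%E.
apply: (@le_trans _ _ (nu U)); first by apply: le_measure; rewrite ?inE.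
pose I := open_disjoint_itv oU.
have mI i : measurable (I i) by apply: open_measurable; exact: open_disjoint_itv_open.
have tI : trivIset setT I by exact: open_disjoint_itv_trivIset.
have UE : U = \bigcup_i I i by exact: open_disjoint_itv_bigcup.
have sI (m : {measure set (measurableTypeR R) -> \bar R}) :
    m U = (\sum_(i <oo) m (I i))%E.
  rewrite {1}UE (@measure_bigcup _ _ _ m setT I (fun i _ => mI i) tI).
  by apply: congr_lim; apply/funext => n; apply: eq_bigl => i; rewrite in_setT.
have Ifin i : (leb (I i) < +oo)%E.
  apply: (@le_lt_trans _ _ (leb U)); last exact: lt_trans (ltry d).
  apply: le_measure; rewrite ?inE//; have : I i `<=` \bigcup_i I i by exact: bigcup_sup.
    by move=> _; exact: mI.
  by rewrite -UE.
have /choice[uv uvE] : forall i, exists uv : R * R, I i = `]uv.1, uv.2[%classic.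
  by move=> i; apply: open_interval_finite_measure => //;
    [exact: open_disjoint_itv_open|exact: open_disjoint_itv_is_interval].
have lebI i : leb (I i) = if (uv i).1 < (uv i).2 then ((uv i).2 - (uv i).1)%:E else 0%E.
  by rewrite uvE lebesgue_measure_itv/= lte_fin.
rewrite (sI nu); apply: lime_le; first by apply: is_cvg_nneseries => n _ _; exact: measure_ge0.
(* Bounding all partial sums is enough, and these are finite families as in the definition of
   absolute continuity. *)
apply: nearW => n; rewrite big_mkord.
(* Empty components are discarded, since their chosen endpoints need not be in order. *)
pose P := [pred i : 'I_n | (uv i).1 < (uv i).2].
have nuI (i : 'I_n) : (nu (I i) <=
    if P i then `|F (clamp a b (uv i).2) - F (clamp a b (uv i).1)|%:E else 0)%E.
  rewrite /= uvE; case: ifPn => uvi; last first.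
    by rewrite set_itv_ge ?measure0// bnd_simp.
  rewrite (@le_trans _ _ (nu `](uv i).1, (uv i).2]%classic))//.
    by apply: le_measure; rewrite ?inE//; exact: subset_itvW.
  have -> : nu `](uv i).1, (uv i).2]%classic = (W (uv i).2 - W (uv i).1)%:E.
    exact: stieltjes_itvoc (ltW uvi).
  by rewrite lee_fin WE ler_norm.
apply: (le_trans (lee_sum _ (fun i _ => nuI i))); rewrite -big_mkcond sumEFin lee_fin ltW//.
apply: (h _ P (fun i => (uv i).1) (fun i => (uv i).2)) => /=.
- by move=> i /ltW.
- move=> i j Pi Pj ij; apply: disjoint_itvoo => //; rewrite -!uvE.
  by apply/eqP; apply: contraNT ij => /set0P ne; apply/eqP/val_inj; exact: (tI i j).
rewrite -lte_fin (le_lt_trans _ Ud)// -sumEFin (sI leb).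
rewrite big_mkcond (le_trans _ (@nneseries_lim_ge _ _ xpredT _ n _))//.
by rewrite big_mkord lee_sum// => i _; rewrite -lebI.
Qed.

Lemma nondecreasing_abs_continuous_density a b F : a <= b ->
  abs_continuous a b F -> {in `[a, b] &, nondecreasing_fun F} ->
  exists g : R -> R, leb.-integrable setT (EFin \o g) /\
    forall x, a <= x <= b -> F x - F a = \int[leb]_(t in `]a, x]) g t.
Proof.
move=> ab acF ndF.
have ndW : nondecreasing (F \o clamp a b).
  by move=> x y xy /=; apply: ndF; rewrite ?in_itv/= ?clamp_itv ?clamp_le.
have rcW : right_continuous (F \o clamp a b).
  exact/right_continuousW/abs_continuous_clamp_continuous.
pose W : cumulative R R := HB.pack (F \o clamp a b) (isCumulative.Build R _ R _ ndW rcW).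
pose nu := lebesgue_stieltjes_measure W.
have mD : measurable (`]a, b]%classic : set (measurableTypeR R)) by exact: measurable_itv.
have nuD : (nu `]a, b]%classic < +oo)%E by rewrite /nu stieltjes_itvoc// ltry.
(* Restriction to []a, b]] yields a finite measure, hence a charge to which Radon-Nikodym
   applies. *)
pose nuf : {finite_measure set (measurableTypeR R) -> \bar R} := mfrestr mD nuD.
have dom : charge_of_finite_measure nuf `<< leb.
  apply/null_content_dominatesP => A mA A0; rewrite /charge_of_finite_measure /=.
  apply: (subset_measure0 (mu := nu) (B := A)) => //; first exact: measurableI.
  by have /null_content_dominatesP := abs_continuous_stieltjes_dominates ab acF (erefl (W : R -> R)); apply.
pose g := Radon_Nikodym (charge_of_finite_measure nuf) leb.
have gfin x : g x \is a fin_num by exact: Radon_Nikodym_fin_num.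
have gE : EFin \o (fine \o g) = g by apply/funext => x /=; rewrite fineK.
exists (fine \o g); split; first by rewrite gE; exact: Radon_Nikodym_integrable.
move=> x axb; have /andP[ax xb] := axb.
have mx : measurable (`]a, x]%classic : set (measurableTypeR R)) by exact: measurable_itv.
rewrite /Rintegral; under eq_integral do rewrite /= fineK//.
rewrite -(Radon_Nikodym_integral dom mx)/= /charge_of_finite_measure /= /mfrestr /mrestr.
rewrite (_ : _ `&` _ = `]a, x]%classic); last first.
  by apply/setIidPl; apply: subset_itvl; rewrite bnd_simp.
by rewrite /nu stieltjes_itvoc//= !clamp_id// lexx.
Qed.

(** With [V] the variation function, [F = V - (V - F)], and both terms are nondecreasing and
    absolutely continuous. *)
Lemma abs_continuous_density a b F : a <= b -> abs_continuous a b F ->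
  exists g : R -> R, leb.-integrable setT (EFin \o g) /\
    forall x, a <= x <= b -> F x - F a = \int[leb]_(t in `]a, x]) g t.
Proof.
move=> ab acF; have bv := abs_continuous_bounded_variation ab acF.
have acV := abs_continuous_vtot ab acF.
have dV x y : x \in `[a, b] -> y \in `[a, b] -> x <= y ->
    `|F y - F x| <= vtot a F y - vtot a F x.
  by rewrite !in_itv/= => /andP[ax _] /andP[_ yb] xy; apply: (vtot_dist bv); rewrite ?ax.
have [|g [ig gE]] := nondecreasing_abs_continuous_density ab acV.
  by move=> x y xab yab xy; rewrite -subr_ge0 (le_trans _ (dV _ _ xab yab xy)).
have [|h [ih hE]] := nondecreasing_abs_continuous_density ab
    (abs_continuousD acV (abs_continuousN acF)).
  move=> x y xab yab xy /=; have := dV _ _ xab yab xy => /(le_trans (ler_norm _)); lra.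
exists (g \- h); split.
  by rewrite (_ : EFin \o _ = (EFin \o g) \- (EFin \o h))%E; [exact: integrableB|].
move=> x axb; have m : measurable (`]a, x]%classic : set (measurableTypeR R)) by exact: measurable_itv.
rewrite RintegralB//; [|exact: integrableS ig|exact: integrableS ih].
by rewrite -gE// -hE//=; ring.
Qed.

Lemma near_eq_derive1D (F G : R -> R) x (c : R) :
  (\forall y \near x, F y = G y + c) -> derivable G x 1 ->
  derivable F x 1 /\ F^`()%classic x = G^`()%classic x.
Proof.
move=> FG dG; have h : is_derive x 1 G (G^`()%classic x).
  by rewrite derive1E; exact: derivableP.
have h' : is_derive x 1 (G \+ cst c) (G^`()%classic x + 0).
  exact: (is_deriveD h (is_derive_cst c x 1)).
have [] : is_derive x 1 F (G^`()%classic x + 0).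
  by apply: near_eq_is_derive h'; apply: filterS FG => y ->.
by rewrite addr0 -derive1E.
Qed.

(** Near an interior point [F] is [F a] plus the integral of its density, and Lebesgue
    differentiation gives the derivative of that integral almost everywhere. *)
Lemma abs_continuous_FTC a b F : a <= b -> abs_continuous a b F ->
  exists g : R -> R, [/\ leb.-integrable setT (EFin \o g),
    forall x, a <= x <= b -> F x - F a = \int[leb]_(t in `]a, x]) g t &
    {ae leb, forall x, a < x < b -> derivable F x 1 /\ F^`()%classic x = g x}].
Proof.
move=> ab acF; have [g [ig gE]] := abs_continuous_density ab acF.
exists g; split => //.
have ig' : forall y, leb.-integrable [set` Interval (BRight a) (BRight y)] (EFin \o g).
  by move=> y; exact: integrableS ig.
have lg : locally_integrable setT g by apply: open_integrable_locally => //; exact: openT.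
have := FTC1 ig' lg => /=.
apply: filterS; first exact: (ae_filter_ringOfSetsType leb).
move=> x /= h /andP[ax xb].
have [|dG GE] := h; first by rewrite lte_fin.
rewrite -GE; apply: (near_eq_derive1D (c := F a)) => //.
near=> y; rewrite -gE ?subrK//; apply/andP; split; apply: ltW; near: y.
  exact: lt_nbhsr.
exact: lt_nbhsl.
Unshelve. all: by end_near. Qed.

End monotone_density.

(** * Integration *)

Section ae_eq_integral_nonmeasurable.
Context d (T : measurableType d) {R : realType} (mu : {measure set T -> \bar R}).
Import HBNNSimple.
Local Open Scope ereal_scope.

(* No measurability is assumed: the k-th derivative of the theorem is only known
   to agree almost everywhere with a measurable function. *)
Lemma ge0_le_integral_outside_null (D N : set T) (f g : T -> \bar R) :
  measurable N -> mu N = 0 ->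
  (forall x, D x -> 0 <= f x) -> (forall x, D x -> 0 <= g x) ->
  (forall x, D x -> ~ N x -> f x = g x) ->
  \int[mu]_(x in D) f x <= \int[mu]_(x in D) g x.
Proof.
move=> mN N0 f0 g0 fg; rewrite !ge0_integralE//; apply: ge_ereal_sup => _ [h hf <-].
have mNC : measurable (~` N) by exact: measurableC.
(* Cutting the simple function [h] off on the null set [N] keeps its integral and brings it below
   [g] everywhere. *)
pose h' := proj_nnsfun h mNC.
have -> : sintegral mu h = sintegral mu h'.
  rewrite -!integralT_nnsfun; apply: ae_eq_integral => //=.
  - exact/measurable_EFinP.
  - by apply/measurable_EFinP; exact: (measurable_funPT h').
  - exists N; split => // x /=; apply: contra_notP => Nx _.
    by rewrite /mindic indicE mem_set ?mulr1.
apply: ereal_sup_ubound; exists h' => // x /=; rewrite /mindic indicE.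
have [Nx|Nx] := pselect (N x).
  rewrite memNset; last by apply.
  by rewrite mulr0 erestrict_ge0.
rewrite mem_set// mulr1 (le_trans (hf x))// !patchE.
by case: ifPn => // /set_mem Dx; rewrite fg.
Qed.

(** The one-sided comparison is used in both directions, on the positive and on the negative
    parts. *)
Lemma ae_eq_integral_nonmeasurable (D : set T) (f g : T -> \bar R) :
  ae_eq mu D f g -> \int[mu]_(x in D) f x = \int[mu]_(x in D) g x.
Proof.
move=> [N [mN N0 fgN]].
have fg x : D x -> ~ N x -> f x = g x.
  by move=> Dx Nx; apply: contrapT => h; apply: Nx; apply: fgN => /(_ Dx).
rewrite integralE [RHS]integralE; congr (_ - _); apply/eqP; rewrite eq_le; apply/andP; split;
  apply: (ge0_le_integral_outside_null mN N0) => // x Dx Nx;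
  by rewrite ?funeposE ?funenegE fg.
Qed.

End ae_eq_integral_nonmeasurable.

(** * Affine changes of variable for the Lebesgue integral *)

Section affine.
Context {R : realType}.
Local Notation leb := (@lebesgue_measure R).

Definition affine (c d x : R) : R := c * x + d.

Lemma measurable_affine (c d : R) : measurable_fun [set: R] (affine c d).
Proof. by apply: measurable_funD => //; exact: measurable_funM. Qed.

Section pushforward_affine.
Variables c d : R.

Definition pushforward_affine : set (measurableTypeR R) -> \bar R :=
  pushforward leb (affine c d : measurableTypeR R -> measurableTypeR R).

Let maff : measurable_fun [set: measurableTypeR R]
  (affine c d : measurableTypeR R -> measurableTypeR R) := measurable_affine c d.

Let pushforward_affine0 : pushforward_affine set0 = 0%E.
Proof. by rewrite /pushforward_affine /pushforward preimage_set0 measure0. Qed.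

Let pushforward_affine_ge0 A : (0 <= pushforward_affine A)%E.
Proof. exact: measure_ge0. Qed.

Let pushforward_affine_sigma_additive : semi_sigma_additive pushforward_affine.
Proof. exact: measure_semi_sigma_additive. Qed.

HB.instance Definition _ := isMeasure.Build _ _ _ pushforward_affine
  pushforward_affine0 pushforward_affine_ge0 pushforward_affine_sigma_additive.

End pushforward_affine.

(** The right-hand side is a measure, so by uniqueness of Lebesgue measure it suffices to compare on
    half-open intervals. For [c < 0] the preimage is half-open on the other side, which has the same
    length. *)
Lemma lebesgue_measure_affine (c d : R) (A : set R) : c != 0 -> measurable A ->
  leb A = (`|c|%:E * leb ((affine c d) @^-1` A))%E.
Proof.
move=> c0 mA; have nc0 : 0 < `|c| by rewrite normr_gt0.
pose m : {measure set (measurableTypeR R) -> \bar R} :=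
  mscale (NngNum (ltW nc0)) (pushforward_affine c d).
suff : leb A = m A by [].
apply: lebesgue_measure_unique => // _ [[u v] _ <-].
rewrite lebesgue_measure_itv/= /m /= /mscale /=.
rewrite -[pushforward_affine _ _ _]/(leb (affine c d @^-1` `]u, v]%classic)).
have [c_lt0|c_gt0|c_eq0] := ltgtP c 0; last by rewrite c_eq0 eqxx in c0.
- rewrite (_ : _ @^-1` _ = `[(v - d) / c, (u - d) / c[%classic).
    rewrite lebesgue_measure_itv/= !lte_fin ltr_nM2r ?invr_lt0// ltrD2r.
    case: ifPn => uv; last by rewrite mule0.
    rewrite -!EFinB -EFinM ltr0_norm//; congr EFin; field.
    by rewrite lt_eqF.
  apply/seteqP; split => x /=; rewrite /affine !in_itv/= ler_ndivrMr// ltr_ndivlMr// => /andP[? ?];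
    by apply/andP; split; lra.
- rewrite (_ : _ @^-1` _ = `](u - d) / c, (v - d) / c]%classic).
    rewrite lebesgue_measure_itv/= !lte_fin ltr_pM2r ?invr_gt0// ltrD2r.
    case: ifPn => uv; last by rewrite mule0.
    rewrite -!EFinB -EFinM gtr0_norm//; congr EFin; field.
    by rewrite gt_eqF.
  apply/seteqP; split => x /=; rewrite /affine !in_itv/= ler_pdivlMr// ltr_pdivrMr// => /andP[? ?];
    by apply/andP; split; lra.
Qed.

Lemma ge0_integral_affine (c d : R) (A : set R) (f : R -> \bar R) : c != 0 ->
  measurable A -> measurable_fun A f -> (forall x, A x -> (0 <= f x)%E) ->
  (\int[leb]_(x in A) f x =
   `|c|%:E * \int[leb]_(x in (affine c d) @^-1` A) f (affine c d x))%E.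
Proof.
move=> c0 mA mf f0; have nc0 : 0 < `|c| by rewrite normr_gt0.
pose m : {measure set (measurableTypeR R) -> \bar R} :=
  mscale (NngNum (ltW nc0)) (pushforward_affine c d).
rewrite (eq_measure_integral m); last first.
  by move=> B mB _; exact: lebesgue_measure_affine.
rewrite /m ge0_integral_mscale//; congr (_ * _)%E.
by apply: (@ge0_integral_pushforward _ _ (measurableTypeR R) (measurableTypeR R) R
  (affine c d) (measurable_affine c d) leb A f) => // x /set_mem; exact: f0.
Qed.

End affine.

(** * Euler's Gamma and Beta integrals *)

Section beta_gamma.
Context {R : realType}.
Local Notation leb := (@lebesgue_measure R).
Implicit Types (p q s t u a b x y : R).

Lemma integral_if_itv (i : interval R) (f : R -> R) :
  (\int[leb]_x (if x \in i then f x else 0)%:E =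
   \int[leb]_(x in [set` i]) (f x)%:E)%E.
Proof.
rewrite [RHS]integral_mkcond; apply: eq_integral => x _.
by rewrite patchE mem_setE; case: ifP.
Qed.

Lemma ge0_integral_affineR (c d : R) (i : interval R) (f : R -> R) : c != 0 ->
  measurable_fun [set: R] f -> (forall x, 0 <= f x) ->
  (\int[leb]_(x in [set` i]) (f x)%:E =
   `|c|%:E * \int[leb]_(x in affine c d @^-1` [set` i]) (f (affine c d x))%:E)%E.
Proof.
move=> c0 mf f0; apply: (@ge0_integral_affine _ c d [set` i] (EFin \o f) c0).
- exact: measurable_itv.
- by apply: measurable_funTS; exact/measurable_EFinP.
- by move=> x _; rewrite lee_fin.
Qed.

Lemma ge0_integralZlR (k : R) (i : interval R) (f : R -> R) : 0 <= k ->
  measurable_fun [set: R] f -> (forall x, 0 <= f x) ->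
  (\int[leb]_(x in [set` i]) (k * f x)%:E =
   k%:E * \int[leb]_(x in [set` i]) (f x)%:E)%E.
Proof.
move=> k0 mf f0; rewrite -[RHS](@ge0_integralZl_EFin _ _ _ leb [set` i] _ (EFin \o f))//.
- by move=> x _; rewrite lee_fin.
- by apply: measurable_funTS; exact/measurable_EFinP.
Qed.

Lemma measurable_powR_comp d (T : measurableType d) (D : set T) (f : T -> R) p :
  measurable_fun D f -> measurable_fun D (fun x : T => f x `^ p).
Proof. by move=> mf; exact: (measurableT_comp (measurable_powR p) mf). Qed.

Lemma continuous_powR p x : 0 < x -> {for x, continuous (fun y : R => y `^ p)}.
Proof.
move=> x0; apply: differentiable_continuous; apply/derivable1_diffP.
by apply: derivable_powR; rewrite in_itv/= x0.
Qed.

(** Away from 0 the integrand is continuous, so the fundamental theorem for continuous functions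
    applies for every exponent. *)
Lemma integral_powR_pos p s t : 0 < s -> s < t ->
  (\int[leb]_(y in `]s, t[) (p * y `^ (p - 1))%:E = (t `^ p - s `^ p)%:E)%E.
Proof.
move=> s0 st.
have c1 : {in `[s, t], continuous (fun y : R => p * y `^ (p - 1))}.
  move=> y; rewrite in_itv/= => /andP[sy _].
  by apply: cvgM; [exact: cvg_cst|exact: continuous_powR (lt_le_trans s0 sy)].
have mw : measurable_fun [set: R] (fun y : R => p * y `^ (p - 1)).
  by apply: measurable_funM => //; exact: measurable_powR.
have := @continuous_FTC2 R (fun y => p * y `^ (p - 1)) (fun y : R => y `^ p) s t st.
rewrite -EFinB => <-.
- rewrite -integral_itv_bndo_bndc; last exact/measurable_EFinP/measurable_funTS.
  by rewrite -integral_itv_obnd_cbnd//; exact/measurable_EFinP/measurable_funTS.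
- exact: continuous_subspace_itv.
- split.
  + by move=> y; rewrite in_itv/= => /andP[sy _]; apply: derivable_powR;
      rewrite in_itv/= (lt_trans s0 sy).
  + by apply: cvg_at_right_filter; exact: continuous_powR.
  + by apply: cvg_at_left_filter; apply: continuous_powR; exact: lt_trans st.
- by move=> y; rewrite in_itv/= => /andP[sy _]; rewrite powR_derive1// in_itv/= (lt_trans s0 sy).
Qed.

Lemma integral_powR p s t : 0 < p -> 0 <= s -> s <= t ->
  (\int[leb]_(y in `]s, t[) (p * y `^ (p - 1))%:E = (t `^ p - s `^ p)%:E)%E.
Proof.
move=> p0; rewrite le_eqVlt => /predU1P[<-|s0]; last first.
  rewrite le_eqVlt => /predU1P[<-|]; last exact: integral_powR_pos.
  by rewrite set_itv_ge ?integral_set0 ?subrr// bnd_simp ltxx.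
rewrite le_eqVlt => /predU1P[<-|t0].
  by rewrite set_itv_ge ?integral_set0 ?subrr// bnd_simp ltxx.
have mw : measurable_fun [set: R] (fun y : R => p * y `^ (p - 1)).
  by apply: measurable_funM => //; exact: measurable_powR.
(* For [s = 0] and [p < 1] the integrand is unbounded, so monotone convergence is used along []r n,
   t[]; the shift [n.+2] keeps [r n < t]. *)
pose r (n : nat) := t / (n.+2)%:R.
have r0 n : 0 < r n by rewrite divr_gt0.
have rt n : r n < t by rewrite ltr_pdivrMr// ltr_pMr// ltr1n.
have rcvg : r n @[n --> \oo] --> 0.
  rewrite -(mulr0 t); apply: cvgM; first exact: cvg_cst.
  by rewrite (cvg_shiftS (fun n => (n.+1%:R : R)^-1)); exact: cvg_harmonic.
pose A n : set (measurableTypeR R) := `]r n, t[%classic.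
have UA : \bigcup_n A n = `]0, t[%classic.
  apply/seteqP; split => [x [n _]|x] /=; rewrite /A/= !in_itv/=.
    by move=> /andP[rx ->]; rewrite (lt_trans (r0 n)).
  move=> /andP[x0 xt].
  have [n _ /(_ _ (leqnn n))] := cvgr_lt _ rcvg _ x0.
  by move=> rx; exists n => //=; rewrite /A/= in_itv/= rx.
have ndA : nondecreasing_seq A.
  move=> m n mn; apply/subsetPset => x; rewrite /A/= !in_itv/= => /andP[rx ->].
  rewrite andbT (le_lt_trans _ rx)// ler_pM2l// lef_pV2 ?posrE// ler_nat.
  by rewrite !ltnS.
have h : (\int[leb]_(x in A n) (p * x `^ (p - 1))%:E @[n --> \oo] -->
    \int[leb]_(x in \bigcup_n A n) (p * x `^ (p - 1))%:E)%E.
  apply: ge0_nondecreasing_set_cvg_integral.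
  - exact: ndA.
  - by move=> n; exact: measurable_itv.
  - by move=> n; apply: measurable_funTS; exact/measurable_EFinP.
  - by move=> n x _; rewrite lee_fin mulr_ge0 ?powR_ge0// ltW.
rewrite UA in h; apply: (cvg_unique _ h) => //.
rewrite (_ : (fun n => _) = (fun n => (t `^ p - r n `^ p)%:E)); last first.
  by apply/funext => n; rewrite integral_powR_pos.
apply: cvg_EFin; first by apply: nearW.
rewrite powR0 ?gt_eqF//; apply: cvgB; first exact: cvg_cst.
by have /cvg_at_rightP := powR_cvg0 p0; apply.
Qed.

Definition gamma_integrand p t : R := t `^ (p - 1) * expR (- t).
Definition beta_integrand p q a b t : R := (t - a) `^ (p - 1) * (b - t) `^ (q - 1).

(** Values in the extended reals let the Tonelli identities be stated before any finiteness is
    known; finiteness is then derived from them. *)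
Definition egamma p : \bar R := (\int[leb]_(t in `]0%R, +oo[) (gamma_integrand p t)%:E)%E.
Definition ebeta p q : \bar R :=
  (\int[leb]_(t in `]0%R, 1%R[) (beta_integrand p q 0 1 t)%:E)%E.

Lemma gamma_integrand_ge0 p t : 0 <= gamma_integrand p t.
Proof. by rewrite mulr_ge0 ?powR_ge0 ?expR_ge0. Qed.

Lemma beta_integrand_ge0 p q a b t : 0 <= beta_integrand p q a b t.
Proof. by rewrite mulr_ge0 ?powR_ge0. Qed.

Lemma measurable_gamma_integrand p : measurable_fun [set: R] (gamma_integrand p).
Proof.
apply: measurable_funM; first exact: measurable_powR.
by apply: measurableT_comp => //; exact: measurableT_comp.
Qed.

Lemma measurable_beta_integrand p q a b : measurable_fun [set: R] (beta_integrand p q a b).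
Proof. by apply: measurable_funM; apply: measurable_powR_comp; exact: measurable_funB. Qed.

Lemma egamma_ge0 p : (0 <= egamma p)%E.
Proof. by apply: integral_ge0 => x _; rewrite lee_fin gamma_integrand_ge0. Qed.

Lemma ebeta_ge0 p q : (0 <= ebeta p q)%E.
Proof. by apply: integral_ge0 => x _; rewrite lee_fin beta_integrand_ge0. Qed.

(** Homogeneity of the Beta integrand; the leading factor [a] is the Jacobian of the scaling. *)
Lemma powR_beta_factor p q a x y : 0 < a -> 0 <= x -> 0 <= y ->
  a * ((a * x) `^ (p - 1) * (a * y) `^ (q - 1)) =
  a `^ (p + q - 1) * (x `^ (p - 1) * y `^ (q - 1)).
Proof.
move=> a0 x0 y0; have ha : 0 <= a by exact: ltW.
have an0 : a != 0 by rewrite gt_eqF.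
rewrite (_ : p + q - 1 = 1 + (p - 1) + (q - 1)); last by ring.
rewrite [a `^ (_ + _)]powRD ?an0 ?implybT// [a `^ (1 + _)]powRD ?an0 ?implybT//.
by rewrite powRr1// !powRM//; ring.
Qed.

Lemma integral_beta_right p q a b : a < b ->
  (\int[leb]_(t in `]a, b[) (beta_integrand p q a b t)%:E =
   ((b - a) `^ (p + q - 1))%:E * ebeta p q)%E.
Proof.
move=> ab; have ba0 : 0 < b - a by rewrite subr_gt0.
have c0 : b - a != 0 by rewrite gt_eqF.
rewrite (ge0_integral_affineR a _ c0 (measurable_beta_integrand p q a b)
  (beta_integrand_ge0 p q a b)).
rewrite (_ : _ @^-1` _ = [set` `]0%R, 1%R[]); last first.
  apply/seteqP; split => y; rewrite /affine /= !in_itv/= => /andP[? ?]; apply/andP; split; nra.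
rewrite (gtr0_norm ba0) /ebeta.
have mc : measurable_fun [set: R] (fun x => beta_integrand p q a b (affine (b - a) a x)).
  by apply: measurableT_comp; [exact: measurable_beta_integrand|exact: measurable_affine].
rewrite -(ge0_integralZlR _ (ltW ba0) mc); last by move=> x; exact: beta_integrand_ge0.
rewrite -(ge0_integralZlR _ (powR_ge0 _ _) (measurable_beta_integrand p q 0 1)
  (beta_integrand_ge0 p q 0 1)).
apply: eq_integral => y /set_mem/=; rewrite in_itv/= => /andP[y0 y1].
congr EFin; rewrite /beta_integrand subr0 -powR_beta_factor// ?(ltW y0)//; last first.
  by rewrite subr_ge0 ltW.
by congr (_ * (_ `^ _ * _ `^ _)); rewrite /affine; ring.
Qed.

(** The reflection [t -> a + b - t] exchanges the two exponents and reduces this to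
    [integral_beta_right]. *)
Lemma integral_beta_left p q a b : a < b ->
  (\int[leb]_(t in `]a, b[) (beta_integrand q p a b t)%:E =
   ((b - a) `^ (p + q - 1))%:E * ebeta p q)%E.
Proof.
move=> ab; have c0 : (-1 : R) != 0 by rewrite oppr_eq0 oner_eq0.
rewrite (ge0_integral_affineR (a + b) _ c0 (measurable_beta_integrand q p a b)
  (beta_integrand_ge0 q p a b)).
rewrite normrN normr1 mul1e -(integral_beta_right p q ab).
rewrite (_ : _ @^-1` _ = [set` `]a, b[]); last first.
  apply/seteqP; split => y; rewrite /affine /= !in_itv/= => /andP[? ?]; apply/andP; split; lra.
apply: eq_integral => y _; congr EFin; rewrite /beta_integrand mulrC.
by congr (_ `^ _ * _ `^ _); rewrite /affine; ring.
Qed.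

Lemma tonelli_swap (K : R -> R -> R) :
  measurable_fun [set: R * R] (fun z => K z.1 z.2) -> (forall x y, 0 <= K x y) ->
  (\int[leb]_t \int[leb]_u (K t u)%:E = \int[leb]_u \int[leb]_t (K t u)%:E)%E.
Proof.
move=> mK K0; have := @fubini_tonelli _ _ (measurableTypeR R) (measurableTypeR R) R leb leb
  (fun z => (K z.1 z.2)%:E).
apply => /=; first exact/measurable_EFinP.
by move=> z; rewrite lee_fin.
Qed.

(** Extension by zero moves the domain [0 < t < u] into the integrand, so the order of integration
    can be exchanged over the whole plane. *)
Definition gamma_kernel p q t u : R :=
  if (0 < t) && (t < u) then t `^ (p - 1) * (u - t) `^ (q - 1) * expR (- u) else 0.

Lemma measurable_gamma_kernel p q :
  measurable_fun [set: R * R] (fun z => gamma_kernel p q z.1 z.2).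
Proof.
apply: measurable_fun_ifT.
- by apply: measurable_and; apply: measurable_fun_ltr.
- apply: measurable_funM; last first.
    by apply: measurableT_comp => //; apply: measurableT_comp.
  by apply: measurable_funM; apply: measurable_powR_comp => //; exact: measurable_funB.
- exact: measurable_cst.
Qed.

(* Tonelli, after the substitution [s = u - t] in the inner integral of
   [t `^ (p - 1) * s `^ (q - 1) * expR (- (t + s))]. *)
Lemma egammaM p q : (egamma p * egamma q = egamma (p + q) * ebeta p q)%E.
Proof.
transitivity (\int[leb]_t \int[leb]_u (gamma_kernel p q t u)%:E)%E.
  rewrite /egamma -ge0_integralZr; last 4 first.
  - exact: measurable_itv.
  - by apply: measurable_funTS; apply/measurable_EFinP; exact: measurable_gamma_integrand.
  - by move=> x _; rewrite lee_fin gamma_integrand_ge0.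
  - exact: egamma_ge0.
  rewrite [LHS]integral_mkcond; apply: eq_integral => t _; rewrite patchE mem_setE in_itv/= andbT.
  case: ifPn => [t0|t0]; last first.
    by rewrite integral0_eq// => u _; rewrite /gamma_kernel (negbTE t0).
  rewrite (ge0_integral_affineR (- t) _ (oner_neq0 R) (measurable_gamma_integrand q)
    (gamma_integrand_ge0 q)).
  rewrite normr1 mul1e (_ : _ @^-1` _ = [set` `]t, +oo[]); last first.
    by apply/seteqP; split => y; rewrite /affine /= !in_itv/= !andbT mul1r subr_gt0.
  have mc : measurable_fun [set: R] (fun x => gamma_integrand q (affine 1 (- t) x)).
    by apply: measurableT_comp; [exact: measurable_gamma_integrand|exact: measurable_affine].
  rewrite -(ge0_integralZlR _ (gamma_integrand_ge0 p t) mc); last first.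
    by move=> x; exact: gamma_integrand_ge0.
  rewrite -integral_if_itv; apply: eq_integral => u _; rewrite in_itv/= andbT /gamma_kernel t0/=.
  case: ifPn => // tu; congr EFin; rewrite /gamma_integrand /affine mul1r.
  rewrite [expR (- u)](_ : _ = expR (- t) * expR (- (u - t))); first by ring.
  by rewrite -expRD; congr expR; ring.
rewrite tonelli_swap; [|exact: measurable_gamma_kernel|]; last first.
  by move=> t u; rewrite /gamma_kernel; case: ifP => // _; rewrite !mulr_ge0 ?powR_ge0 ?expR_ge0.
rewrite /egamma -ge0_integralZr; last 4 first.
- exact: measurable_itv.
- by apply: measurable_funTS; apply/measurable_EFinP; exact: measurable_gamma_integrand.
- by move=> x _; rewrite lee_fin gamma_integrand_ge0.
- exact: ebeta_ge0.
rewrite [RHS]integral_mkcond; apply: eq_integral => u _.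
rewrite patchE mem_setE in_itv/= andbT; case: ifPn => [u0|u0]; last first.
  rewrite integral0_eq// => t _; rewrite /gamma_kernel; case: ifPn => // /andP[t0 tu].
  by rewrite (lt_trans t0 tu) in u0.
(* For fixed [u] the inner integral is the Beta integral over []0, u[], up to the factor
   [expR (- u)]. *)
have := integral_beta_right p q u0; rewrite subr0 => hb.
rewrite /gamma_integrand mulrC EFinM -muleA -hb.
rewrite -(ge0_integralZlR _ (expR_ge0 _) (measurable_beta_integrand p q 0 u)
  (beta_integrand_ge0 p q 0 u)).
rewrite -integral_if_itv; apply: eq_integral => t _; rewrite in_itv/= /gamma_kernel.
by case: ifPn => // _; congr EFin; rewrite /beta_integrand subr0 mulrC.
Qed.

End beta_gamma.

Section gamma.
Context {R : realType}.
Local Notation leb := (@lebesgue_measure R).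
Implicit Types (p q s t u a b x y : R).

Lemma ebetap1 p : 0 < p -> ebeta p 1 = (p^-1)%:E.
Proof.
move=> p0; have mp : measurable_fun [set: R] (fun t : R => t `^ (p - 1)) by exact: measurable_powR.
have := integral_powR p0 (lexx 0) ler01.
rewrite (ge0_integralZlR _ (ltW p0) mp); last by move=> x; exact: powR_ge0.
rewrite powR1 (powR0 (lt0r_neq0 p0)) subr0 => h.
have -> : ebeta p 1 = (\int[leb]_(t in [set` `]0%R, 1%R[]) (t `^ (p - 1))%:E)%E.
  by apply: eq_integral => t _; rewrite /beta_integrand subr0 subrr powRr0 mulr1.
have := congr1 (fun z => (p^-1)%:E * z)%E h.
by rewrite muleA -EFinM (mulVf (lt0r_neq0 p0)) mul1e mule1.
Qed.

Lemma egamma1 : egamma 1 = 1%E :> \bar R.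
Proof.
rewrite -(@integral_exponential_pdf R 1 ltr01).
have -> : (\int[leb]_x (exponential_pdf 1 x)%:E =
    \int[leb]_(x in [set` `[0%R, +oo[]) (1 * expR (- 1 * x))%:E)%E.
  rewrite [RHS]integral_mkcond; apply: eq_integral => x _.
  by rewrite /exponential_pdf !patchE; case: ifP.
rewrite -integral_itv_obnd_cbnd; last first.
  apply: measurable_funTS; apply/measurable_EFinP; apply: measurable_funM => //.
  by apply: measurableT_comp => //; exact: measurable_funM.
apply: eq_integral => x _; congr EFin.
by rewrite /gamma_integrand subrr powRr0 mul1r mulN1r mul1r.
Qed.

(** The case [q = 1] of [egammaM], as Gamma(1) = 1 and Beta(p, 1) = 1/p. *)
Lemma egammaS p : 0 < p -> egamma (p + 1) = (p%:E * egamma p)%E.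
Proof.
move=> p0; have := egammaM p 1; rewrite egamma1 mule1 (ebetap1 p0) => ->.
by rewrite muleC -muleA -EFinM (mulVf (lt0r_neq0 p0)) mule1.
Qed.

Lemma egamma_nat n : egamma (n.+1%:R : R) = (n`!%:R)%:E.
Proof.
elim: n => [|n IH]; first by rewrite egamma1.
by rewrite -natr1 egammaS ?ltr0n// IH -EFinM -natrM factS.
Qed.

(** On []0, 1[] the integrand is below [t ^ (p - 1)], integrable because [p > 0]; beyond 1 it is
    below the integrand for an integer argument at least [p], whose integral is a factorial. *)
Lemma egamma_lty p : 0 < p -> (egamma p < +oo)%E.
Proof.
move=> p0; pose n := Num.trunc p.
have pn : p <= n.+1%:R by rewrite ltW// truncnS_gt.
have mp : measurable_fun [set: R] (fun t : R => t `^ (p - 1)) by exact: measurable_powR.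
pose k t : R := if t \in `]0, 1[ then t `^ (p - 1) else 0.
have k0 t : 0 <= k t by rewrite /k; case: ifP => // _; exact: powR_ge0.
have mk : measurable_fun [set: R] k.
  by apply: measurable_fun_ifT => //; under eq_fun do rewrite in_itv/=;
    apply: measurable_and; exact: measurable_fun_ltr.
have ik : (\int[leb]_(t in [set` `]0%R, +oo[]) (k t)%:E < +oo)%E.
  apply: (@le_lt_trans _ _ (\int[leb]_t (k t)%:E)%E).
    apply: ge0_subset_integral => //; first exact/measurable_EFinP.
    by move=> t _; rewrite lee_fin.
  rewrite integral_if_itv; have := integral_powR p0 (lexx 0) ler01.
  rewrite (ge0_integralZlR _ (ltW p0) mp); last by move=> x; exact: powR_ge0.
  case: (integral _ _ _) => [r| |] //.
    by rewrite ltry.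
  by rewrite gt0_muley// lte_fin.
apply: (@le_lt_trans _ _ (\int[leb]_(t in [set` `]0%R, +oo[])
    ((k t)%:E + (gamma_integrand n.+1%:R t)%:E))%E).
  apply: ge0_le_integral.
  - exact: measurable_itv.
  - by move=> t _; rewrite lee_fin gamma_integrand_ge0.
  - by apply: measurable_funTS; apply/measurable_EFinP; exact: measurable_gamma_integrand.
  - apply: measurable_funTS; apply: emeasurable_funD; apply/measurable_EFinP => //.
    exact: measurable_gamma_integrand.
  - move=> t /=; rewrite in_itv/= andbT => t0; rewrite -EFinD lee_fin /k in_itv/= t0/=.
    case: ifPn => [t1|]; rewrite /gamma_integrand.
      rewrite (@le_trans _ _ (t `^ (p - 1)))//.
        by rewrite ler_piMr ?powR_ge0// -expR0 ler_expR oppr_le0 ltW.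
      by rewrite lerDl mulr_ge0 ?powR_ge0 ?expR_ge0.
    rewrite -leNgt => t1; rewrite add0r ler_wpM2r ?expR_ge0//.
    by apply: ler_powR => //; rewrite lerB.
rewrite ge0_integralD.
- by rewrite lte_add_pinfty// -/(egamma _) egamma_nat ltry.
- exact: measurable_itv.
- by move=> t _; rewrite lee_fin.
- by apply: measurable_funTS; exact/measurable_EFinP.
- by move=> t _; rewrite lee_fin gamma_integrand_ge0.
- by apply: measurable_funTS; apply/measurable_EFinP; exact: measurable_gamma_integrand.
Qed.

Lemma egammaE p : 0 < p -> egamma p = (Gamma p)%:E.
Proof. by move=> p0; rewrite /Gamma /Rintegral fineK// ge0_fin_numE ?egamma_lty// egamma_ge0. Qed.

Lemma GammaS p : 0 < p -> Gamma (p + 1) = p * Gamma p.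
Proof. by move=> p0; apply: EFin_inj; rewrite EFinM -!egammaE ?egammaS// addr_gt0. Qed.

Lemma Gamma_nat n : Gamma (n.+1%:R : R) = n`!%:R.
Proof. by apply: EFin_inj; rewrite -egammaE ?egamma_nat// ltr0n. Qed.

(** On []0, 1[] the exponential is at least [expR (- 1)], and the integral of [t ^ (p - 1)] is
    nonzero because [p] times it equals 1. *)
Lemma Gamma_gt0 p : 0 < p -> 0 < Gamma p.
Proof.
move=> p0; rewrite -lte_fin -egammaE//.
have mp : measurable_fun [set: R] (fun t : R => t `^ (p - 1)) by exact: measurable_powR.
have e0 : 0 <= expR (- 1) :> R by exact: expR_ge0.
have h := integral_powR p0 (lexx 0) ler01.
rewrite (ge0_integralZlR _ (ltW p0) mp) in h; last by move=> x; exact: powR_ge0.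
rewrite powR1 (powR0 (lt0r_neq0 p0)) subr0 in h.
apply: (@lt_le_trans _ _ (\int[leb]_(t in [set` `]0%R, 1%R[]) (expR (- 1) * t `^ (p - 1))%:E)%E).
  rewrite (ge0_integralZlR _ e0 mp); last by move=> x; exact: powR_ge0.
  apply: mule_gt0; first by rewrite lte_fin expR_gt0.
  rewrite lt0e integral_ge0 ?andbT; last by move=> x _; rewrite lee_fin powR_ge0.
  by apply/eqP => h0; move: h; rewrite h0 mule0 => /eqP; rewrite eq_sym onee_eq0.
apply: (@le_trans _ _ (\int[leb]_(t in [set` `]0%R, 1%R[]) (gamma_integrand p t)%:E)%E).
  apply: ge0_le_integral.
  - exact: measurable_itv.
  - by move=> t _; rewrite lee_fin mulr_ge0 ?powR_ge0.
  - by apply: measurable_funTS; apply/measurable_EFinP; exact: measurable_funM.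
  - by apply: measurable_funTS; apply/measurable_EFinP; exact: measurable_gamma_integrand.
  - move=> t /=; rewrite in_itv/= => /andP[t0 t1]; rewrite lee_fin mulrC ler_wpM2l ?powR_ge0//.
    by rewrite ler_expR lerN2 ltW.
apply: ge0_subset_integral.
- exact: measurable_itv.
- exact: measurable_itv.
- by apply: measurable_funTS; apply/measurable_EFinP; exact: measurable_gamma_integrand.
- by move=> t _; rewrite lee_fin gamma_integrand_ge0.
- by move=> t /=; rewrite !in_itv/= => /andP[->].
Qed.

(** An infinite Beta integral would make the finite product of Gamma values infinite in [egammaM]; a
    finite one is obtained by division. *)
Lemma ebetaE p q : 0 < p -> 0 < q ->
  ebeta p q = (Gamma p * Gamma q / Gamma (p + q))%:E.
Proof.
move=> p0 q0; have pq0 : 0 < p + q by rewrite addr_gt0.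
have := egammaM p q; rewrite !egammaE//.
have g0 := Gamma_gt0 pq0.
case: (ebeta p q) (ebeta_ge0 p q) => [r| |] // _.
  by rewrite -!EFinM => -[->]; congr EFin; rewrite mulrAC divff ?mul1r// gt_eqF.
by rewrite gt0_muley// lte_fin.
Qed.

End gamma.

(** * Riemann-Liouville kernels *)

Section kernel_fubini.
Context {R : realType}.
Local Notation leb := (@lebesgue_measure R).
Implicit Types (p q s t u a b x y : R).

(** The kernel is nonnegative with mass [C s] in [t], so the double integral of the absolute value
    is that of [|g| * C], which is finite, and Fubini applies. The almost everywhere integrability
    in [s] is what later allows constants to be pulled out of the inner integral. *)
Lemma kernel_fubini (i : interval R) (K : R -> R -> R) (g C : R -> R) :
  measurable_fun [set: R * R] (fun z => K z.1 z.2) -> (forall t s, 0 <= K t s) ->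
  (forall t s, s \notin i -> K t s = 0) ->
  (forall s, s \in i -> (\int[leb]_t (K t s)%:E = (C s)%:E)%E) ->
  measurable_fun [set: R] g ->
  leb.-integrable [set` i] (EFin \o (fun s => g s * C s)) ->
  {ae leb, forall t, leb.-integrable setT (fun s => (g s * K t s)%:E)} /\
  (\int[leb]_t \int[leb]_s (g s * K t s)%:E = \int[leb]_(s in [set` i]) (g s * C s)%:E)%E.
Proof.
move=> mK K0 Ki KC mg igC.
pose T := measurableTypeR R.
pose f (z : T * T) : \bar R := (g z.2 * K z.1 z.2)%:E.
have mf : measurable_fun setT f.
  apply/measurable_EFinP; apply: measurable_funM => //.
  exact: (measurableT_comp (f := g) mg).
have mKs s : measurable_fun setT (fun t : T => (K t s)%:E).
  apply/measurable_EFinP; exact: (measurableT_comp mK (measurable_pair2 s)).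
have inner (k : R) s : (\int[leb]_t (k * K t s)%:E =
    if s \in i then (k * C s)%:E else 0)%E.
  case: ifPn => si; last first.
    by apply: integral0_eq => t _; rewrite Ki// mulr0.
  under eq_integral do rewrite EFinM.
  rewrite integralZl//; first by rewrite KC.
  apply/integrableP; split => //.
  under eq_integral => t _ do rewrite gee0_abs ?lee_fin//.
  by rewrite KC// ltry.
have intf : (leb \x leb)%E.-integrable setT f.
  apply/(integrable21ltyP _ _ mf).
  have -> : (\int[leb]_s \int[leb]_t `|f (t, s)| =
      \int[leb]_s if s \in i then `|(g s * C s)%:E| else 0)%E.
    apply: eq_integral => s _; transitivity (\int[leb]_t (`|g s| * K t s)%:E)%E.
      by apply: eq_integral => t _; rewrite /f/= normrM [`|K t s|]ger0_norm.
    rewrite inner; case: ifPn => // si; rewrite /= normrM [`|C s|]ger0_norm//.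
    by rewrite -lee_fin -KC// integral_ge0// => t _; rewrite lee_fin.
  move/integrableP : igC => [_]; rewrite integral_mkcond.
  by under [in X in X -> _]eq_integral do rewrite patchE mem_setE.
split; first exact: (ae_integrable1 intf).
rewrite (Fubini intf) /f/= [RHS]integral_mkcond.
by apply: eq_integral => s _; rewrite inner patchE mem_setE.
Qed.

(* [s] is the variable of the inner (fractional) integral, [t] that of the outer
   one. *)
Definition left_kernel p q a b t s : R :=
  if (a < s) && (s < t) && (t < b) then beta_integrand q p s b t else 0.

Definition right_kernel p q a b t s : R :=
  if (a < t) && (t < s) && (s < b) then beta_integrand p q a s t else 0.

Lemma measurable_left_kernel p q a b :
  measurable_fun [set: R * R] (fun z => left_kernel p q a b z.1 z.2).
Proof.
apply: measurable_fun_ifT.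
- by apply: measurable_and; first apply: measurable_and; apply: measurable_fun_ltr.
- by apply: measurable_funM; apply: measurable_powR_comp => //; exact: measurable_funB.
- exact: measurable_cst.
Qed.

Lemma measurable_right_kernel p q a b :
  measurable_fun [set: R * R] (fun z => right_kernel p q a b z.1 z.2).
Proof.
apply: measurable_fun_ifT.
- by apply: measurable_and; first apply: measurable_and; apply: measurable_fun_ltr.
- by apply: measurable_funM; apply: measurable_powR_comp => //; exact: measurable_funB.
- exact: measurable_cst.
Qed.

Let B p q := Gamma p * Gamma q / Gamma (p + q).

(** For fixed [s] the integral over [t] in []s, b[] is a Beta integral, which gives the mass [C s]
    of [kernel_fubini]. *)
Lemma left_kernel_fubini p q a b (g : R -> R) : 0 < p -> 0 < q ->
  measurable_fun [set: R] g ->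
  leb.-integrable [set` `]a, b[] (EFin \o (fun s => g s * (b - s) `^ (p + q - 1))) ->
  {ae leb, forall t, leb.-integrable setT (fun s => (g s * left_kernel p q a b t s)%:E)} /\
  (\int[leb]_t \int[leb]_s (g s * left_kernel p q a b t s)%:E =
   (B p q)%:E * \int[leb]_(s in [set` `]a, b[]) (g s * (b - s) `^ (p + q - 1))%:E)%E.
Proof.
move=> p0 q0 mg ig.
have -> : ((B p q)%:E * \int[leb]_(s in [set` `]a, b[]) (g s * (b - s) `^ (p + q - 1))%:E =
    \int[leb]_(s in [set` `]a, b[]) (g s * ((b - s) `^ (p + q - 1) * B p q))%:E)%E.
  rewrite -[LHS]integralZl//; apply: eq_integral => s _.
  by rewrite /= -EFinM; congr EFin; ring.
apply: kernel_fubini => //.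
- exact: measurable_left_kernel.
- by move=> t s; rewrite /left_kernel; case: ifP => // _; exact: beta_integrand_ge0.
- move=> t s; rewrite in_itv/= negb_and -!leNgt /left_kernel; case: ifPn => //.
  move=> /andP[/andP[h1 h2] h3] /orP[] h; lra.
- move=> s; rewrite in_itv/= => /andP[as_ sb].
  rewrite EFinM -ebetaE// -integral_beta_left// -integral_if_itv.
  by apply: eq_integral => t _; rewrite /left_kernel as_ in_itv.
- have : leb.-integrable [set` `]a, b[]
      (fun s => (B p q)%:E * (g s * (b - s) `^ (p + q - 1))%:E)%E.
    by apply: integrableZl => //; exact: measurable_itv.
  by apply: eq_integrable => //= s _; rewrite -EFinM; congr EFin; ring.
Qed.

Lemma right_kernel_fubini p q a b (g : R -> R) : 0 < p -> 0 < q ->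
  measurable_fun [set: R] g ->
  leb.-integrable [set` `]a, b[] (EFin \o (fun s => g s * (s - a) `^ (p + q - 1))) ->
  {ae leb, forall t, leb.-integrable setT (fun s => (g s * right_kernel p q a b t s)%:E)} /\
  (\int[leb]_t \int[leb]_s (g s * right_kernel p q a b t s)%:E =
   (B p q)%:E * \int[leb]_(s in [set` `]a, b[]) (g s * (s - a) `^ (p + q - 1))%:E)%E.
Proof.
move=> p0 q0 mg ig.
have -> : ((B p q)%:E * \int[leb]_(s in [set` `]a, b[]) (g s * (s - a) `^ (p + q - 1))%:E =
    \int[leb]_(s in [set` `]a, b[]) (g s * ((s - a) `^ (p + q - 1) * B p q))%:E)%E.
  rewrite -[LHS]integralZl//; apply: eq_integral => s _.
  by rewrite /= -EFinM; congr EFin; ring.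
apply: kernel_fubini => //.
- exact: measurable_right_kernel.
- by move=> t s; rewrite /right_kernel; case: ifP => // _; exact: beta_integrand_ge0.
- move=> t s; rewrite in_itv/= negb_and -!leNgt /right_kernel; case: ifPn => //.
  move=> /andP[/andP[h1 h2] h3] /orP[] h; lra.
- move=> s; rewrite in_itv/= => /andP[as_ sb].
  rewrite EFinM -ebetaE// -integral_beta_right// -integral_if_itv.
  by apply: eq_integral => t _; rewrite /right_kernel sb andbT in_itv.
- have : leb.-integrable [set` `]a, b[]
      (fun s => (B p q)%:E * (g s * (s - a) `^ (p + q - 1))%:E)%E.
    by apply: integrableZl => //; exact: measurable_itv.
  by apply: eq_integrable => //= s _; rewrite -EFinM; congr EFin; ring.
Qed.

End kernel_fubini.

(** * Riemann-Stieltjes integration by parts *)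

Section riemann_stieltjes.
Context {R : realType}.
Local Notation leb := (@lebesgue_measure R).
Implicit Types (a b s t x y : R) (phi w H V k : R -> R).

Lemma fine_partition a b (d : R) : a < b -> 0 < d -> exists s : seq R,
  itv_partition a b s /\
  forall i, (i < size s)%N -> subdiv a b s i.+1 - subdiv a b s i < d.
Proof.
move=> ab d0; pose n := (Num.trunc ((b - a) / d)).+1.
have n0 : 0 < n%:R :> R by rewrite ltr0n.
have nd : (b - a) / n%:R < d.
  by rewrite ltr_pdivrMr// mulrC -ltr_pdivrMr// truncnS_gt.
pose u (i : nat) : R := a + (b - a) * (i%:R / n%:R).
pose s := mkseq (fun i => u i.+1) n.
have us i : (i <= n)%N -> subdiv a b s i = u i.
  case: i => [_|i ni]; first by rewrite /subdiv/= /u mul0r mulr0 addr0.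
  by rewrite /subdiv/= nth_mkseq.
have ss : size s = n by rewrite size_mkseq.
have uS i : u i.+1 - u i = (b - a) / n%:R by rewrite /u -natr1; field; rewrite gt_eqF.
exists s; split; last first.
  by move=> i; rewrite ss => ni; rewrite !us// ?(ltnW ni)// uS.
split.
- apply/(pathP b) => i; rewrite ss => ni.
  rewrite -[nth b (a :: s) i]/(subdiv a b s i) -[nth b s i]/(subdiv a b s i.+1).
  by rewrite !us// ?(ltnW ni)// -subr_gt0 uS divr_gt0// subr_gt0.
- rewrite (last_nth b) ss -[nth _ _ _]/(subdiv a b s n) us// /u divff; last by rewrite gt_eqF.
  by apply/eqP; ring.
Qed.

(** Both candidates are close to the same sum on one partition fine enough for both. This determines
    the value that [xget] selects in [RS_integral]. *)
Lemma is_RS_integral_unique a b phi g (I J : R) : a < b ->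
  is_RS_integral a b phi g I -> is_RS_integral a b phi g J -> I = J.
Proof.
move=> ab hI hJ; apply/eqP; rewrite -subr_eq0 -normr_le0; apply/ler_addgt0Pr => e e0.
have e20 : 0 < e / 2 by rewrite divr_gt0.
have [d d0 {}hI] := hI _ e20; have [d' d'0 {}hJ] := hJ _ e20.
have m0 : 0 < Num.min d d' by rewrite lt_min d0.
have [s [sP sd]] := fine_partition ab m0.
have /= h1 := hI s (subdiv a b s) sP; have /= h2 := hJ s (subdiv a b s) sP.
have nd i : (i < size s)%N -> subdiv a b s i <= subdiv a b s i.+1.
  by move=> si; apply: subdiv_nondecreasing => //; rewrite inE// ltnW.
have {}h1 : `|RS_sum a b phi g s (subdiv a b s) - I| < e / 2.
  by apply: h1 => i si; rewrite lexx nd//; split => //;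
    have := sd _ si; rewrite lt_min => /andP[].
have {}h2 : `|RS_sum a b phi g s (subdiv a b s) - J| < e / 2.
  by apply: h2 => i si; rewrite lexx nd//; split => //;
    have := sd _ si; rewrite lt_min => /andP[].
rewrite add0r (splitr e) ltW//.
rewrite (_ : I - J = (RS_sum a b phi g s (subdiv a b s) - J) -
  (RS_sum a b phi g s (subdiv a b s) - I)); last by ring.
by rewrite (le_lt_trans (ler_normB _ _))// ltrD.
Qed.

Lemma RS_integralE a b phi g (I : R) : a < b ->
  is_RS_integral a b phi g I -> RS_integral a b phi g = I.
Proof.
move=> ab hI; apply: xget_subset1 => // J K.
exact: is_RS_integral_unique.
Qed.

Lemma is_RS_integralN a b phi g (I : R) :
  is_RS_integral a b phi g I -> is_RS_integral a b (\- phi) g (- I).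
Proof.
move=> hI e /hI[d d0 {}hI]; exists d => // s xi sP h.
rewrite (_ : _ - - I = - (RS_sum a b phi g s xi - I)) ?normrN; first exact: hI.
rewrite opprB opprK addrC; congr (_ + _); rewrite /RS_sum -sumrN.
by apply: eq_bigr => i _; rewrite mulNr.
Qed.

Section by_parts.
(** [phi] is a primitive of a nonnegative weight [w] that may be unbounded, and [V] is any function
    whose increments dominate those of [H]. [k] is a globally measurable stand-in for [H] on the
    open interval. *)
Variables (a b : R) (phi w H V k : R -> R).
Hypotheses (ab : a < b) (mw : measurable_fun [set: R] w) (w0 : forall x, 0 <= w x).
Hypothesis phiE : forall s t, a <= s -> s <= t -> t <= b ->
  (\int[leb]_(y in [set` `]s, t[]) (w y)%:E = (phi t - phi s)%:E)%E.
Hypothesis phi_unif : forall e : R, 0 < e -> exists2 d : R, 0 < d &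
  forall s t, a <= s -> s <= t -> t <= b -> t - s < d -> phi t - phi s < e.
Hypothesis HV : forall s t, a <= s -> s <= t -> t <= b -> `|H t - H s| <= V t - V s.
Hypotheses (mk : measurable_fun [set: R] k) (kH : {in `]a, b[, k =1 H}).

Let iw s t : a <= s -> s <= t -> t <= b -> leb.-integrable [set` `]s, t[] (EFin \o w).
Proof.
move=> as_ st tb; apply/integrableP; split.
  by apply: measurable_funTS; exact/measurable_EFinP.
have -> : (\int[leb]_(x in [set` `]s, t[]) `|(EFin \o w) x| =
    \int[leb]_(x in [set` `]s, t[]) (w x)%:E)%E.
  by apply: eq_integral => x _ /=; rewrite ger0_norm.
by rewrite phiE// ltry.
Qed.

Let RphiE s t : a <= s -> s <= t -> t <= b ->
  \int[leb]_(y in [set` `]s, t[]) w y = phi t - phi s.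
Proof. by move=> as_ st tb; rewrite /Rintegral phiE. Qed.

Let phi_le s t : a <= s -> s <= t -> t <= b -> phi s <= phi t.
Proof.
move=> as_ st tb; rewrite -subr_ge0 -lee_fin -phiE//.
by apply: integral_ge0 => x _; rewrite lee_fin.
Qed.

(** Inside the interval [k] is bounded by [|H a|] plus the total increment of [V], and [w] is
    integrable. *)
Lemma by_parts_integrable : leb.-integrable [set` `]a, b[] (EFin \o (fun y => w y * k y)).
Proof.
pose M : R := `|H a| + (V b - V a).
have Vab : 0 <= V b - V a by rewrite (le_trans _ (HV (lexx a) (ltW ab) (lexx b))).
have M0 : 0 <= M by rewrite addr_ge0.
apply: (le_integrable (measurable_itv _ : measurable ([set` `]a, b[] : set (measurableTypeR R)))
  (g := EFin \o (fun y => M * w y))).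
- by apply: measurable_funTS; apply/measurable_EFinP; exact: measurable_funM.
- move=> x; rewrite /= in_itv/= => /andP[ax xb]; rewrite lee_fin !normrM mulrC ler_wpM2r//.
  rewrite (kH (_ : x \in `]a, b[)) ?in_itv/= ?ax// [leRHS]ger0_norm// -[H x](subrK (H a)) addrC.
  rewrite (le_trans (ler_normD _ _))// lerD2l (le_trans (HV (lexx a) (ltW ax) (ltW xb)))//.
  by rewrite lerD2r -subr_ge0 (le_trans _ (HV (ltW ax) (ltW xb) (lexx b))).
- have : leb.-integrable [set` `]a, b[] (fun y => M%:E * (w y)%:E)%E.
    by apply: integrableZl; [exact: measurable_itv|exact: iw (lexx a) (ltW ab) (lexx b)].
  by apply: eq_integrable; [exact: measurable_itv|move=> y _ /=; rewrite EFinM].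
Qed.

Let P t := \int[leb]_(y in [set` `]a, t[]) (w y * k y).

Let sub_integrable s t : a <= s -> t <= b ->
  leb.-integrable [set` `]s, t[] (EFin \o (fun y => w y * k y)).
Proof.
move=> as_ tb; apply: integrableS by_parts_integrable; [exact: measurable_itv..|].
by apply: subset_itv; rewrite bnd_simp.
Qed.

Let PB s t : a <= s -> s <= t -> t <= b ->
  P t - P s = \int[leb]_(y in [set` `]s, t[]) (w y * k y).
Proof.
move=> as_ st tb; rewrite /P.
have [<-|ast] := eqVneq a s.
  by rewrite [X in _ - X](_ : _ = 0) ?subr0// set_itv_ge ?Rintegral_set0// bnd_simp ltxx.
have lt_as : a < s by rewrite lt_neqAle ast.
have [<-|sneqt] := eqVneq s t.
  rewrite subrr set_itv_ge ?Rintegral_set0// bnd_simp ltxx//.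
have lt_st : s < t by rewrite lt_neqAle sneqt.
rewrite -(@Rintegral_itvB R (fun y => w y * k y) (BRight a) (BLeft t) s).
- congr (_ - _); apply: Rintegral_itv_bndo_bndc.
  by apply: sub_integrable => //; exact: le_trans tb.
- exact: sub_integrable.
- by rewrite bnd_simp.
- by rewrite bnd_simp.
Qed.

(** On []s, t[] the value [k y] differs from [H s] by at most [V t - V s]; integrating against [w]
    gives the bound. *)
Let local_estimate s t : a <= s -> s <= t -> t <= b ->
  `|(P t - P s) - H s * (phi t - phi s)| <= (V t - V s) * (phi t - phi s).
Proof.
move=> as_ st tb; rewrite PB// -RphiE//.
have i1 := iw as_ st tb; have i2 := sub_integrable as_ tb.
have mst : measurable ([set` `]s, t[] : set (measurableTypeR R)) by exact: measurable_itv.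
have iZ c : leb.-integrable [set` `]s, t[] (EFin \o (fun y => c * w y)).
  have : leb.-integrable [set` `]s, t[] (fun y => c%:E * (w y)%:E)%E by exact: integrableZl.
  by apply: eq_integrable => // y _ /=; rewrite EFinM.
rewrite -!RintegralZl// -RintegralB//.
have iD : leb.-integrable [set` `]s, t[] (EFin \o (fun y => w y * k y - H s * w y)).
  have := integrableB mst i2 (iZ (H s)).
  by apply: eq_integrable => // y _ /=; rewrite EFinB.
apply: (le_trans (le_normr_Rintegral mst iD)); apply: le_Rintegral => //.
  have := integrable_norm iD; by apply: eq_integrable.
move=> y; rewrite /= in_itv/= => /andP[sy yt].
rewrite mulrC -mulrBl normrM [`|w y|]ger0_norm// ler_wpM2r//.
have ys : a < y by exact: le_lt_trans sy.
rewrite kH; last by rewrite in_itv/= ys (lt_le_trans yt).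
rewrite (le_trans (HV as_ (ltW sy) (le_trans (ltW yt) tb)))// lerD2r -subr_ge0.
by rewrite (le_trans _ (HV (ltW ys) (ltW yt) tb)).
Qed.

(* Both the choice of the tags and the replacement of [H] by its left endpoint
   values cost at most the sum of [(phi t' - phi t) * (V t' - V t)] over the
   cells [[t, t']], which is small because [phi] is uniformly continuous and the
   increments of [V] telescope. *)
Lemma RS_by_parts : is_RS_integral a b phi H
  (phi b * H b - phi a * H a - \int[leb]_(y in [set` `]a, b[]) (w y * k y)).
Proof.
move=> e e0.
have Vab : 0 <= V b - V a by rewrite (le_trans _ (HV (lexx a) (ltW ab) (lexx b))).
pose X : R := V b - V a.
(* The factor 2 counts the two errors, from the tags and from freezing [H]; the 1 keeps the
   denominator positive when [X = 0]. *)
have D0 : 0 < 2 * X + 1 by rewrite ltr_wpDl// mulr_ge0.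
have e'0 : 0 < e / (2 * X + 1) by rewrite divr_gt0.
have [d d0 dP] := phi_unif e'0; exists d => // s xi sP hs.
pose t i := subdiv a b s i.
have tab i : (i <= size s)%N -> a <= t i /\ t i <= b.
  by move=> si; have /andP[] := subdiv_itv sP si.
have tt i : (i < size s)%N -> t i <= t i.+1.
  by move=> si; apply: subdiv_nondecreasing => //; rewrite inE// ltnW.
(* Summation by parts: the boundary terms and the integral are written as telescoping sums over the
   cells. *)
have E : RS_sum a b phi H s xi -
    (phi b * H b - phi a * H a - \int[leb]_(y in [set` `]a, b[]) (w y * k y)) =
    \sum_(0 <= i < size s) ((phi (xi i) - phi (t i.+1)) * (H (t i.+1) - H (t i)) +
      ((P (t i.+1) - P (t i)) - H (t i) * (phi (t i.+1) - phi (t i)))).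
  have -> : \int[leb]_(y in [set` `]a, b[]) (w y * k y) = P b - P a.
    by rewrite PB ?lexx// ltW.
  rewrite -(sum_subdiv (fun y => phi y * H y) sP) -(sum_subdiv P sP) /RS_sum.
  by rewrite -!sumrB; apply: eq_bigr => i _; rewrite /t; ring.
rewrite E; apply: (@le_lt_trans _ _ (\sum_(0 <= i < size s)
    (2 * (e / (2 * X + 1))) * (V (t i.+1) - V (t i)))).
  rewrite (le_trans (ler_norm_sum _ _ _))// big_nat_cond [leRHS]big_nat_cond.
  apply: ler_sum => i /andP[/andP[_ si] _].
  have [at_ tb] := tab i (ltnW si); have [at' tb'] := tab i.+1 si.
  have {}tt := tt i si; have [td /andP[x1 x2]] := hs i si.
  have hd := ltW (dP _ _ at_ tt tb' td).
  have h1 := local_estimate at_ tt tb'.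
  have h2 := HV at_ tt tb'.
  have h3 : `|phi (xi i) - phi (t i.+1)| <= phi (t i.+1) - phi (t i).
    rewrite distrC ger0_norm; last first.
      by rewrite subr_ge0 phi_le// (le_trans at_).
    by rewrite lerD2l lerN2 phi_le// (le_trans x2).
  have h0 : 0 <= V (t i.+1) - V (t i) by rewrite (le_trans _ h2).
  rewrite (le_trans (ler_normD _ _))// -mulrA mulr_natl mulr2n lerD//.
    by rewrite normrM ler_pM// (le_trans h3).
  by rewrite (le_trans h1)// mulrC ler_wpM2r.
rewrite -mulr_sumr (sum_subdiv V sP) -/X.
have qe : e / (2 * X + 1) * (2 * X + 1) = e by rewrite divfK// gt_eqF.
rewrite -[ltRHS]qe; move: e'0; set q := e / _ => q0; lra.
Qed.

End by_parts.

End riemann_stieltjes.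

(** * One-sided limits of functions of bounded variation *)

Section bounded_variation_limits.
Context {R : realType}.
Implicit Types (a b s t x y : R) (f h V : R -> R).

Lemma nondecreasing_cvg_at_right a b f : a < b ->
  {in `[a, b] &, nondecreasing_fun f} -> cvg (f @ a^'+).
Proof.
move=> ab nf; apply: cvgP; apply: (@nondecreasing_at_right_cvgr _ f a (BRight b)).
- by rewrite bnd_simp.
- by move=> x y; rewrite !in_itv/= => /andP[/ltW ? ?] /andP[/ltW ? ?]; apply: nf;
    rewrite in_itv/=; apply/andP.
- exists (f a) => _ [x /= + <-]; rewrite in_itv/= => /andP[/ltW ax xb].
  by apply: nf => //; rewrite in_itv/= ?ax ?xb ?lexx ?(ltW ab).
Qed.

Lemma nondecreasing_cvg_at_left a b f : a < b ->
  {in `[a, b] &, nondecreasing_fun f} -> cvg (f @ b^'-).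
Proof.
move=> ab nf; apply: nondecreasing_at_left_is_cvgr.
  near=> z; have az : a < z by near: z; exact: nbhs_left_gt.
  move=> x y; rewrite !in_itv/= => /andP[zx xb] /andP[zy yb]; apply: nf; rewrite in_itv/=.
    by rewrite (ltW xb) (ltW (lt_trans az zx)).
  by rewrite (ltW yb) (ltW (lt_trans az zy)).
near=> z; have az : a < z by near: z; exact: nbhs_left_gt.
exists (f b) => _ [x /= + <-]; rewrite in_itv/= => /andP[zx xb].
by apply: nf; rewrite ?in_itv/= ?lexx ?(ltW ab) ?(ltW xb) ?(ltW (lt_trans az zx)).
Unshelve. all: by end_near. Qed.

Section bv.
Variables (a b : R) (h : R -> R).
Hypotheses (ab : a < b) (bv : bounded_variation a b h).

Let V := vtot a h.

Let hV s t : a <= s -> s <= t -> t <= b -> `|h t - h s| <= V t - V s.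
Proof. by move=> as_ st tb; apply: (vtot_dist bv) => //; rewrite as_. Qed.

Let ndV : {in `[a, b] &, nondecreasing_fun V}.
Proof.
move=> s t; rewrite !in_itv/= => /andP[as_ sb] /andP[at_ tb] st.
by rewrite -subr_ge0 (le_trans _ (hV as_ st tb)).
Qed.

Let ndVh : {in `[a, b] &, nondecreasing_fun (V \- h)}.
Proof.
move=> s t; rewrite !in_itv/= => /andP[as_ sb] /andP[at_ tb] st /=.
have := le_trans (ler_norm _) (hV as_ st tb); lra.
Qed.

(** The Jordan decomposition into nondecreasing functions, from which the one-sided limits
    follow. *)
Let hE : h = V \- (V \- h).
Proof. by apply/funext => x /=; ring. Qed.

Lemma bounded_variation_cvg_at_right : cvg (h @ a^'+).
Proof. by rewrite hE; apply: is_cvgB; apply: nondecreasing_cvg_at_right ab _. Qed.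

Lemma bounded_variation_cvg_at_left : cvg (h @ b^'-).
Proof. by rewrite hE; apply: is_cvgB; apply: nondecreasing_cvg_at_left ab _. Qed.

Lemma measurable_bounded_variation_clamp : measurable_fun [set: R] (h \o clamp a b).
Proof.
have nd f : {in `[a, b] &, nondecreasing_fun f} -> measurable_fun [set: R] (f \o clamp a b).
  move=> nf; apply: nondecreasing_measurable => // x y xy /=; apply: nf;
    by rewrite ?in_itv/= ?(clamp_itv _ (ltW ab)) ?clamp_le.
rewrite (_ : h \o clamp a b = (V \o clamp a b) \- ((V \- h) \o clamp a b)).
  by apply: measurable_funB; exact: nd.
by apply/funext => x /=; ring.
Qed.

Let H := no_end_jumps a b h.
Let W := no_end_jumps a b V.

Let dist_right t : a < t -> t < b -> `|h t - H a| <= V t - W a.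
Proof.
move=> at_ tb; rewrite /H /W /no_end_jumps eqxx.
have ch := bounded_variation_cvg_at_right.
have cV : cvg (V @ a^'+) by exact: nondecreasing_cvg_at_right ab ndV.
have c1 : `|h t - h s| @[s --> a^'+] --> `|h t - lim (h @ a^'+)|.
  by apply: cvg_norm; apply: cvgB => //; exact: cvg_cst.
have c2 : V t - V s @[s --> a^'+] --> V t - lim (V @ a^'+).
  by apply: cvgB => //; exact: cvg_cst.
apply: (ler_cvg_to c1 c2).
near=> s; apply: hV; last exact: ltW.
  by apply: ltW; near: s; exact: nbhs_right_gt.
by apply: ltW; near: s; exact: nbhs_right_lt.
Unshelve. all: by end_near. Qed.

(** The constants [y] and [z] are free so that passing to the limit at [b] serves both for an
    interior left point and for [a] with its limit values. *)
Let dist_left (y z m : R) : a < m -> m < b ->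
  (forall t, m < t -> t < b -> `|h t - y| <= V t - z) -> `|H b - y| <= W b - z.
Proof.
move=> am mb hm; rewrite /H /W /no_end_jumps (gt_eqF ab) eqxx.
have ch := bounded_variation_cvg_at_left.
have cV : cvg (V @ b^'-) by exact: nondecreasing_cvg_at_left ab ndV.
have c1 : `|h s - y| @[s --> b^'-] --> `|lim (h @ b^'-) - y|.
  by apply: cvg_norm; apply: cvgB => //; exact: cvg_cst.
have c2 : V s - z @[s --> b^'-] --> lim (V @ b^'-) - z.
  by apply: cvgB => //; exact: cvg_cst.
apply: (ler_cvg_to c1 c2).
near=> s; apply: hm; near: s; [exact: nbhs_left_gt|exact: nbhs_left_lt].
Unshelve. all: by end_near. Qed.

Lemma no_end_jumps_itv x : a < x -> x < b -> no_end_jumps a b h x = h x.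
Proof. by move=> ax xb; rewrite /no_end_jumps (gt_eqF ax) (lt_eqF xb). Qed.

(** The witness is the variation function with its own endpoint values replaced by one-sided limits:
    the inequality between increments survives the passage to the limit at each end. *)
Lemma no_end_jumps_dist : exists V' : R -> R, forall s t, a <= s -> s <= t -> t <= b ->
  `|no_end_jumps a b h t - no_end_jumps a b h s| <= V' t - V' s.
Proof.
exists W => s t; rewrite -/H; rewrite le_eqVlt => /predU1P[<-|as_].
  rewrite le_eqVlt => /predU1P[<-|at_]; first by rewrite !subrr normr0.
  rewrite le_eqVlt => /predU1P[->|tb].
    apply: (@dist_left _ _ ((a + b) / 2)); [by rewrite midf_lt|by rewrite midf_lt|].
    by move=> u mu; apply: dist_right; apply: lt_trans mu; rewrite midf_lt.
  rewrite {1}/H {1}/W no_end_jumps_itv// {1}/no_end_jumps (gt_eqF at_) (lt_eqF tb).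
  exact: dist_right.
rewrite le_eqVlt => /predU1P[<-|st]; first by rewrite !subrr normr0.
move=> tb; have sb := lt_le_trans st tb.
have Hs : H s = h s by exact: no_end_jumps_itv.
have Ws : W s = V s by rewrite /W /no_end_jumps (gt_eqF as_) (lt_eqF sb).
rewrite Hs Ws; move: tb; rewrite le_eqVlt => /predU1P[tb|tb].
  rewrite tb; apply: (@dist_left _ _ s) => // u su ub.
  by apply: hV; apply: ltW.
have at_ := lt_trans as_ st.
have -> : H t = h t by exact: no_end_jumps_itv.
have -> : W t = V t by rewrite /W /no_end_jumps (gt_eqF at_) (lt_eqF tb).
by apply: hV; apply: ltW.
Qed.

End bv.
End bounded_variation_limits.

(** * Powers as Riemann-Stieltjes integrands *)

Section power_functions.
Context {R : realType}.
Local Notation leb := (@lebesgue_measure R).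
Implicit Types (a b s t x y p : R).

(** Write [(s + t) ^ p] as [(s + t) * (s + t) ^ (p - 1)], distribute, and use that [x ^ (p - 1)] is
    nonincreasing. *)
Lemma powR_subadditive p s t : 0 < p -> p <= 1 -> 0 <= s -> 0 <= t ->
  (s + t) `^ p <= s `^ p + t `^ p.
Proof.
move=> p0 p1 s0 t0.
have pn0 : p != 0 by rewrite gt_eqF.
have [->|sn0] := eqVneq s 0; first by rewrite add0r powR0// add0r.
have [->|tn0] := eqVneq t 0; first by rewrite addr0 powR0// addr0.
have {}s0 : 0 < s by rewrite lt_neqAle eq_sym sn0.
have {}t0 : 0 < t by rewrite lt_neqAle eq_sym tn0.
have dec x y : 0 < x -> x <= y -> y `^ (p - 1) <= x `^ (p - 1).
  move=> x0 xy; rewrite -opprB !powRN lef_pV2 ?posrE ?powR_gt0//; last exact: lt_le_trans xy.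
  by apply: ge0_ler_powR => //; rewrite ?nnegrE ?subr_ge0//; [exact: ltW|exact: le_trans (ltW x0) xy].
rewrite -!(@mulr_powRB1 _ _ p)//; try exact: ltW; last by rewrite addr_ge0 ?ltW.
rewrite mulrDl lerD// ler_pM2l// dec// ?lerDl ?lerDr; exact: ltW.
Qed.

Lemma powR_lipschitz p L s t : 1 <= p -> 0 <= s -> s <= t -> t <= L ->
  t `^ p - s `^ p <= p * L `^ (p - 1) * (t - s).
Proof.
move=> p1 s0 st tL; have p0 : 0 < p by exact: lt_le_trans p1.
have L0 : 0 <= L by rewrite (le_trans s0)// (le_trans st).
rewrite -lee_fin -integral_powR//.
apply: (@le_trans _ _ (\int[leb]_(y in [set` `]s, t[]) (p * L `^ (p - 1))%:E)%E); last first.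
  rewrite integral_cst//= lebesgue_measure_itv/= lte_fin EFinM; case: ifPn => [_|].
    by rewrite lexx.
  by rewrite mule0 lee_fin mulr_ge0 ?mulr_ge0 ?powR_ge0 ?subr_ge0// ltW.
apply: ge0_le_integral.
- exact: measurable_itv.
- by move=> y _; rewrite lee_fin mulr_ge0 ?powR_ge0// ltW.
- apply: measurable_funTS; apply/measurable_EFinP; exact: measurable_funM.
- exact: measurable_cst.
- move=> y; rewrite /= in_itv/= => /andP[sy yt]; rewrite lee_fin ler_pM2l//.
  have y0 : 0 <= y by rewrite (le_trans s0)// ltW.
  by apply: ge0_ler_powR; rewrite ?nnegrE ?subr_ge0// (le_trans (ltW yt)).
Qed.

(** For [p <= 1] subadditivity bounds the increment by [(t - s) ^ p], whence [d = e ^ (1/p)]; for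
    [p >= 1] the power is Lipschitz on bounded sets. *)
Lemma powR_unif_continuous p L : 0 < p -> forall e : R, 0 < e -> exists2 d : R, 0 < d &
  forall s t, 0 <= s -> s <= t -> t <= L -> t - s < d -> t `^ p - s `^ p < e.
Proof.
move=> p0 e e0; have [p1|/ltW p1] := leP p 1.
  exists (e `^ p^-1); first exact: powR_gt0.
  move=> s t s0 st _ ts; have ts0 : 0 <= t - s by rewrite subr_ge0.
  have := powR_subadditive p0 p1 s0 ts0; rewrite (addrC s) subrK => h.
  rewrite (@le_lt_trans _ _ ((t - s) `^ p)) ?lerBlDl//.
  rewrite -[ltRHS](powRr1 (ltW e0)) -(mulVf (lt0r_neq0 p0)) powRrM.
  by apply: gt0_ltr_powR => //; rewrite nnegrE ?powR_ge0.
have M0 : 0 < p * (Num.max L 0) `^ (p - 1) + 1 by rewrite ltr_wpDl// mulr_ge0 ?powR_ge0// ltW.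
exists (e / (p * (Num.max L 0) `^ (p - 1) + 1)); first by rewrite divr_gt0.
move=> s t s0 st tL; rewrite ltr_pdivlMr// => h.
rewrite (le_lt_trans _ h)// (le_trans (powR_lipschitz p1 s0 st (_ : t <= Num.max L 0)))//.
  by rewrite le_max tL.
by rewrite mulrC ler_wpM2l ?subr_ge0// lerDl.
Qed.

Lemma integral_powR_right p a s t : 0 < p -> a <= s -> s <= t ->
  (\int[leb]_(y in [set` `]s, t[]) (p * (y - a) `^ (p - 1))%:E =
   ((t - a) `^ p - (s - a) `^ p)%:E)%E.
Proof.
move=> p0 as_ st; have sa0 : 0 <= s - a by rewrite subr_ge0.
have sta : s - a <= t - a by rewrite lerD2r.
rewrite -(integral_powR p0 sa0 sta).
have mf : measurable_fun [set: R] (fun y : R => p * y `^ (p - 1)).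
  by apply: measurable_funM => //; exact: measurable_powR.
have f0 (y : R) : 0 <= p * y `^ (p - 1) by rewrite mulr_ge0 ?powR_ge0// ltW.
rewrite (ge0_integral_affineR (- a) _ (oner_neq0 R) mf f0) normr1 mul1e.
rewrite (_ : _ @^-1` _ = [set` `]s, t[]); last first.
  by apply/seteqP; split => y; rewrite /affine /= !in_itv/= mul1r !ltrD2r.
by apply: eq_integral => y _; rewrite /affine mul1r.
Qed.

Lemma integral_powR_left p b s t : 0 < p -> s <= t -> t <= b ->
  (\int[leb]_(y in [set` `]s, t[]) (p * (b - y) `^ (p - 1))%:E =
   ((b - s) `^ p - (b - t) `^ p)%:E)%E.
Proof.
move=> p0 st tb; have bt0 : 0 <= b - t by rewrite subr_ge0.
have bts : b - t <= b - s by rewrite lerB.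
rewrite -(integral_powR p0 bt0 bts).
have mf : measurable_fun [set: R] (fun y : R => p * y `^ (p - 1)).
  by apply: measurable_funM => //; exact: measurable_powR.
have f0 (y : R) : 0 <= p * y `^ (p - 1) by rewrite mulr_ge0 ?powR_ge0// ltW.
have c0 : (-1 : R) != 0 by rewrite oppr_eq0 oner_eq0.
rewrite (ge0_integral_affineR b _ c0 mf f0) normrN normr1 mul1e.
rewrite (_ : _ @^-1` _ = [set` `]s, t[]); last first.
  by apply/seteqP; split => y; rewrite /affine /= !in_itv/= => /andP[? ?]; apply/andP; split; lra.
by apply: eq_integral => y _; rewrite /affine mulN1r addrC.
Qed.

Lemma RintegralZ_clamp p a b (u h : R -> R) : 0 < p -> a < b ->
  leb.-integrable [set` `]a, b[] (EFin \o (fun y => p * u y * (h \o clamp a b) y)) ->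
  \int[leb]_(y in [set` `]a, b[]) (p * u y * (h \o clamp a b) y) =
  p * \int[leb]_(y in [set` `]a, b[]) (u y * h y).
Proof.
move=> p0 ab ih; have pn0 := lt0r_neq0 p0.
have mab : measurable ([set` `]a, b[] : set (measurableTypeR R)) by exact: measurable_itv.
have uh (y : R) : y \in `]a, b[ -> p * (u y * h y) = p * u y * (h \o clamp a b) y.
  by rewrite in_itv/= => /andP[/ltW ay /ltW yb]; rewrite /= clamp_id ?ay// mulrA.
rewrite -RintegralZl//; last first.
  have := integrableZl mab p^-1 ih; apply: eq_integrable => // y /set_mem yab.
  rewrite /=; have /= E := uh _ yab.
  by rewrite -E -EFinM; congr EFin; rewrite mulKf.
by apply: eq_Rintegral => y /set_mem yab; rewrite uh.
Qed.

(** The power vanishes at [a], so only the boundary term at [b] is left, where [no_end_jumps] takes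
    the left limit of [h]. *)
Lemma RS_integral_open_right p a b h : 0 < p -> a < b -> bounded_variation a b h ->
  RS_integral_open a b (fun t : R => (t - a) `^ p) h =
  (b - a) `^ p * lim (h @ b^'-)
  - p * \int[leb]_(y in [set` `]a, b[]) ((y - a) `^ (p - 1) * h y).
Proof.
move=> p0 ab bv; have [V HV] := no_end_jumps_dist ab bv.
have mu_ : measurable_fun [set: R] (fun y : R => (y - a) `^ (p - 1)).
  by apply: measurable_powR_comp; exact: measurable_funB.
have mw : measurable_fun [set: R] (fun y : R => p * (y - a) `^ (p - 1)) by exact: measurable_funM.
have w0 (y : R) : 0 <= p * (y - a) `^ (p - 1) by rewrite mulr_ge0 ?powR_ge0// ltW.
have phiE (s t : R) : a <= s -> s <= t -> t <= b ->
  (\int[leb]_(y in [set` `]s, t[]) (p * (y - a) `^ (p - 1))%:E =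
    ((t - a) `^ p - (s - a) `^ p)%:E)%E.
  by move=> as_ st _; exact: integral_powR_right.
have unif (e : R) : 0 < e -> exists2 d : R, 0 < d &
  forall s t, a <= s -> s <= t -> t <= b -> t - s < d -> (t - a) `^ p - (s - a) `^ p < e.
  move=> /(powR_unif_continuous (b - a) p0)[d d0 dP]; exists d => // s t as_ st tb ts.
  by apply: dP; rewrite ?subr_ge0 ?lerD2r// opprB addrA subrK.
have mk := measurable_bounded_variation_clamp ab bv.
have kH : {in `]a, b[, h \o clamp a b =1 no_end_jumps a b h}.
  move=> y; rewrite in_itv/= => /andP[ay yb].
  by rewrite /= clamp_id ?(ltW ay) ?(ltW yb)// no_end_jumps_itv.
have ih := by_parts_integrable ab mw w0 phiE HV mk kH.
rewrite /RS_integral_open (RS_integralE ab (RS_by_parts ab mw w0 phiE unif HV mk kH)).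
rewrite (RintegralZ_clamp p0 ab ih) subrr (powR0 (lt0r_neq0 p0)) mul0r subr0.
by rewrite /no_end_jumps (gt_eqF ab) eqxx.
Qed.

Lemma RS_integral_open_left p a b h : 0 < p -> a < b -> bounded_variation a b h ->
  RS_integral_open a b (fun t : R => (b - t) `^ p) h =
  p * \int[leb]_(y in [set` `]a, b[]) ((b - y) `^ (p - 1) * h y)
  - (b - a) `^ p * lim (h @ a^'+).
Proof.
move=> p0 ab bv; have [V HV] := no_end_jumps_dist ab bv.
have mu_ : measurable_fun [set: R] (fun y : R => (b - y) `^ (p - 1)).
  by apply: measurable_powR_comp; exact: measurable_funB.
have mw : measurable_fun [set: R] (fun y : R => p * (b - y) `^ (p - 1)) by exact: measurable_funM.
have w0 (y : R) : 0 <= p * (b - y) `^ (p - 1) by rewrite mulr_ge0 ?powR_ge0// ltW.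
(* Integration by parts is stated for the primitive of a nonnegative weight; [(b - t) ^ p]
   decreases, so it is applied to the opposite and the sign is restored at the end. *)
pose phi (t : R) := - (b - t) `^ p.
have phiE (s t : R) : a <= s -> s <= t -> t <= b ->
  (\int[leb]_(y in [set` `]s, t[]) (p * (b - y) `^ (p - 1))%:E = (phi t - phi s)%:E)%E.
  by move=> as_ st tb; rewrite (integral_powR_left p0 st tb) /phi opprK addrC.
have unif (e : R) : 0 < e -> exists2 d : R, 0 < d &
  forall s t, a <= s -> s <= t -> t <= b -> t - s < d -> phi t - phi s < e.
  move=> /(powR_unif_continuous (b - a) p0)[d d0 dP]; exists d => // s t as_ st tb ts.
  rewrite /phi opprK addrC; apply: dP; rewrite ?subr_ge0 ?lerB//.
  by rewrite opprB addrC addrA subrK.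
have mk := measurable_bounded_variation_clamp ab bv.
have kH : {in `]a, b[, h \o clamp a b =1 no_end_jumps a b h}.
  move=> y; rewrite in_itv/= => /andP[ay yb].
  by rewrite /= clamp_id ?(ltW ay) ?(ltW yb)// no_end_jumps_itv.
have ih := by_parts_integrable ab mw w0 phiE HV mk kH.
have := is_RS_integralN (RS_by_parts ab mw w0 phiE unif HV mk kH).
rewrite (_ : \- phi = fun t : R => (b - t) `^ p); last by apply/funext => t; rewrite /phi/= opprK.
move=> /(RS_integralE ab); rewrite -/(RS_integral_open _ _ _ _) => ->.
rewrite (RintegralZ_clamp p0 ab ih) /phi subrr (powR0 (lt0r_neq0 p0)) oppr0 mul0r.
by rewrite /no_end_jumps eqxx; ring.
Qed.

End power_functions.

(** * Taylor's formula *)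

Section relative_derivatives.
Context {R : realType}.
Implicit Types (a b x y t : R) (f g : R -> R).

(** The two forms of the difference quotient differ by the translation [z = y + h], carried out on
    sequences. *)
Lemma dquot_is_derive g y (l : R) :
  (g z - g y) / (z - y) @[z --> y^'] --> l -> is_derive y 1 g l.
Proof.
move=> /cvgr_dnbhsP h.
have : h^-1 *: ((g \o shift y) (h *: 1) - g y) @[h --> 0^'] --> l.
  apply/cvgr_dnbhsP => u [u0 ucvg].
  have := h (fun n => u n + y); rewrite (_ : (fun n => _ / _) =
    (fun n => (u n)^-1 *: ((g \o shift y) (u n *: 1) - g y))); last first.
    by apply/funext => n; rewrite addrK/= [_ *: 1]mulr1 mulrC.
  apply; split; first by move=> n; rewrite -subr_eq0 addrK.
  by rewrite -[X in _ --> X]add0r; apply: cvgD => //; exact: cvg_cst.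
by move=> c; apply: DeriveDef; [exact: cvgP c|exact: cvg_lim c].
Qed.

Lemma derivable_dquot g y : derivable g y 1 ->
  (g z - g y) / (z - y) @[z --> y^'] --> g^`()%classic y.
Proof.
move=> dg; rewrite derive1E.
have /cvgr_dnbhsP h : h^-1 *: ((g \o shift y) (h *: 1) - g y) @[h --> 0^'] --> 'D_1 g y by exact: dg.
apply/cvgr_dnbhsP => u [u0 ucvg].
have := h (fun n => u n - y); rewrite (_ : (fun n => _ *: _) =
  (fun n => (g (u n) - g y) / (u n - y))); last first.
  by apply/funext => n; rewrite /= [_ *: 1]mulr1 subrK [_ *: _]mulrC.
apply; split; first by move=> n; rewrite subr_eq0.
by rewrite -(subrr y); apply: cvgB => //; exact: cvg_cst.
Qed.

Section on_segment.
Variables (a b : R).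
Hypothesis ab : a < b.
Let A : set R := `[a, b]%classic.

(** At an interior point a limit relative to the segment is thus an ordinary limit; at the endpoints
    it becomes a one-sided one. *)
Lemma within_itv_dnbhs y : a < y -> y < b -> within A y^' `<=` y^'.
Proof.
move=> ay yb P; rewrite /within /= => wP.
near=> z; apply: (near wP) => //; rewrite /A/= in_itv/=; apply/andP; split; apply: ltW; near: z.
  by apply: nbhs_dnbhs; exact: lt_nbhsr.
by apply: nbhs_dnbhs; exact: lt_nbhsl.
Unshelve. all: by end_near. Qed.

Lemma within_itv_at_right : within A a^' `<=` a^'+.
Proof.
move=> P; rewrite /within /= /at_right => wP.
have wP' : \forall z \near a, z != a -> A z -> P z by exact: wP.
have {}wP' : \forall z \near a^'+, z != a -> A z -> P z by exact: (cvg_within _ wP').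
near=> z; have az : a < z by near: z; exact: nbhs_right_gt.
apply: (near wP') => //.
by rewrite /A/= in_itv/= (ltW az)/=; apply: ltW; near: z; exact: nbhs_right_lt.
Unshelve. all: by end_near. Qed.

Lemma within_itv_at_left : within A b^' `<=` b^'-.
Proof.
move=> P; rewrite /within /= /at_left => wP.
have wP' : \forall z \near b, z != b -> A z -> P z by exact: wP.
have {}wP' : \forall z \near b^'-, z != b -> A z -> P z by exact: (cvg_within _ wP').
near=> z; have zb : z < b by near: z; exact: nbhs_left_lt.
apply: (near wP') => //.
by rewrite /A/= in_itv/= (ltW zb) andbT; apply: ltW; near: z; exact: nbhs_left_gt.
Unshelve. all: by end_near. Qed.

Lemma derivable1_on_cvg g y (F : set_system R) : within A y^' `<=` F ->
  derivable1_on A g y -> (g z - g y) / (z - y) @[z --> F] --> derive1_on A g y.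
Proof. by move=> wF dg; apply: cvg_trans dg; exact: cvg_app. Qed.

Lemma derivable1_on_continuous g y (F : set_system R) : Filter F -> nbhs y `<=` F ->
  within A y^' `<=` F -> F (fun z => z != y) ->
  derivable1_on A g y -> g z @[z --> F] --> g y.
Proof.
move=> FF yF wF Fy dg; have q := derivable1_on_cvg wF dg.
have : (g z - g y) / (z - y) * (z - y) + g y @[z --> F] --> derive1_on A g y * (y - y) + g y.
  apply: cvgD; last exact: cvg_cst.
  apply: cvgM => //; apply: cvgB; last exact: cvg_cst.
  exact: yF.
rewrite subrr mulr0 add0r; apply: cvg_trans; apply: near_eq_cvg.
by apply: filterS Fy => z zy; rewrite divfK ?subr_eq0// subrK.
Qed.

Variables (n : nat) (f : R -> R).
Hypothesis df : n_derivable_on A n f.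
Let D j := derive1n_on A j f.

Lemma derive1n_on_itv j y : (j <= n)%N -> a < y -> y < b -> D j y = f^`(j)%classic y.
Proof.
elim: j y => [//|j IH] y jn ay yb.
have dD : derivable1_on A (D j) y by apply: df => //; rewrite /A/= in_itv/= !ltW.
have q := derivable1_on_cvg (within_itv_dnbhs ay yb) dD.
have : is_derive y 1 (f^`(j)%classic) (derive1_on A (D j) y).
  apply: dquot_is_derive; apply: cvg_trans q; apply: near_eq_cvg.
  have near_y : \forall z \near y^', a < z < b.
    apply: nbhs_dnbhs; near=> z; apply/andP; split; near: z; [exact: lt_nbhsr|exact: lt_nbhsl].
  by apply: filterS near_y => z /andP[az zb]; rewrite !IH// ltnW.
by case=> _; rewrite derive1nS derive1E => ->.
Unshelve. all: by end_near. Qed.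

Lemma derive1n_on_is_derive j y : (j < n)%N -> a < y -> y < b ->
  is_derive y 1 (D j) (D j.+1 y).
Proof.
move=> jn ay yb; apply: dquot_is_derive.
apply: (derivable1_on_cvg (within_itv_dnbhs ay yb)).
by apply: df => //; rewrite /A/= in_itv/= !ltW.
Qed.

Lemma n_derivable_at_derivable m g y : n_derivable_at m g y ->
  forall j, (j < m)%N -> derivable (g^`(j)%classic) y 1.
Proof.
elim: m => [//|m IH] [nm dm] j; rewrite ltnS leq_eqVlt => /predU1P[->//|jm].
by apply: IH => //; exact: nbhs_singleton nm.
Qed.

(** The classical quotient at [a] converges from both sides, in particular from the right, where it
    coincides with the relative one by induction and by agreement inside the segment. *)
Lemma derive1n_on_left j : n_derivable_at n f a -> (j <= n)%N -> D j a = f^`(j)%classic a.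
Proof.
move=> na; elim: j => [//|j IH] jn.
have dD : derivable1_on A (D j) a by apply: df => //; rewrite /A/= in_itv/= lexx ltW.
have q := derivable1_on_cvg within_itv_at_right dD.
have q' := cvg_dnbhs_at_right (derivable_dquot (n_derivable_at_derivable na jn)).
rewrite derive1nS; apply: (cvg_unique _ q); first exact: Rhausdorff.
apply: cvg_trans q'; apply: near_eq_cvg; rewrite IH ?(ltnW jn)//.
by near=> z; rewrite derive1n_on_itv// ltnW.
Unshelve. all: by end_near. Qed.

Lemma derive1n_on_right j : n_derivable_at n f b -> (j <= n)%N -> D j b = f^`(j)%classic b.
Proof.
move=> na; elim: j => [//|j IH] jn.
have dD : derivable1_on A (D j) b by apply: df => //; rewrite /A/= in_itv/= lexx ltW.
have q := derivable1_on_cvg within_itv_at_left dD.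
have q' := cvg_dnbhs_at_left (derivable_dquot (n_derivable_at_derivable na jn)).
rewrite derive1nS; apply: (cvg_unique _ q); first exact: Rhausdorff.
apply: cvg_trans q'; apply: near_eq_cvg; rewrite IH ?(ltnW jn)//.
by near=> z; rewrite derive1n_on_itv// ltnW.
Unshelve. all: by end_near. Qed.

Lemma derive1n_on_within_continuous j : (j < n)%N -> {within `[a, b], continuous (D j)}.
Proof.
move=> jn; apply/continuous_within_itvP => //; split.
- move=> y; rewrite in_itv/= => /andP[ay yb]; apply: differentiable_continuous.
  by apply/derivable1_diffP; have [] := derive1n_on_is_derive jn ay yb.
- apply: derivable1_on_continuous.
  + by rewrite /at_right; exact: (@cvg_within _ (nbhs a)).
  + exact: within_itv_at_right.
  + by near=> z; rewrite gt_eqF//; near: z; exact: nbhs_right_gt.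
  + by apply: df => //; rewrite /A/= in_itv/= lexx ltW.
- apply: derivable1_on_continuous.
  + by rewrite /at_left; exact: (@cvg_within _ (nbhs b)).
  + exact: within_itv_at_left.
  + by near=> z; rewrite lt_eqF//; near: z; exact: nbhs_left_lt.
  + by apply: df => //; rewrite /A/= in_itv/= lexx ltW.
Unshelve. all: by end_near. Qed.

Hypothesis acD : abs_continuous a b (D n).

(** Descending induction from [n]: a derivative that is absolutely continuous is bounded, so by the
    mean value theorem the one below it is Lipschitz. *)
Lemma derive1n_on_abs_continuous j : (j <= n)%N -> abs_continuous a b (D j).
Proof.
move=> jn; rewrite -(subKn jn); elim: (n - j)%N (leq_subr j n) => [|i IH] ni; first by rewrite subn0.
have [M M0 hM] := abs_continuous_bounded (ltW ab) (IH (ltnW ni)).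
have lt_n : (n - i.+1 < n)%N by rewrite ltn_subrL/= (leq_ltn_trans _ ni).
apply: (@lipschitz_abs_continuous _ _ _ _ M) => x y /andP[ax xy] yb.
move: xy; rewrite le_eqVlt => /predU1P[<-|xy]; first by rewrite !subrr normr0 mulr0.
have [||c] := @MVT _ (D (n - i.+1)) (D (n - i)) x y xy.
- move=> z; rewrite in_itv/= => /andP[xz zy]; rewrite -(subnSK ni).
  by apply: derive1n_on_is_derive => //; [exact: le_lt_trans xz|exact: lt_le_trans yb].
- apply: continuous_subspaceW (derive1n_on_within_continuous lt_n).
  by apply: subset_itv; rewrite bnd_simp.
rewrite in_itv/= => /andP[xc cy] ->; rewrite normrM [`|y - x|]gtr0_norm ?subr_gt0//.
rewrite ler_wpM2r ?subr_ge0 ?(ltW xy)// hM// (le_trans ax (ltW xc))/=.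
by rewrite (le_trans (ltW cy)).
Qed.

End on_segment.
End relative_derivatives.

Section taylor.
Context {R : realType}.
Local Notation leb := (@lebesgue_measure R).
Implicit Types (a b x y t : R) (f g : R -> R).

Definition taylor_sum (D : nat -> R -> R) (n : nat) x t : R :=
  \sum_(j < n) D j t / j`!%:R * (x - t) ^+ j.

Lemma taylor_sum_center (D : nat -> R -> R) n x : taylor_sum D n.+1 x x = D 0 x.
Proof.
rewrite /taylor_sum big_ord_recl/= fact0 divr1 expr0 mulr1 big1 ?addr0// => i _.
by rewrite subrr expr0n mulr0.
Qed.

Lemma taylor_sumS (D : nat -> R -> R) n x :
  taylor_sum D n.+1 x = taylor_sum D n x \+ (fun t => D n t / n`!%:R * (x - t) ^+ n).
Proof. by apply/funext => t; rewrite /taylor_sum big_ord_recr. Qed.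

Lemma eq_is_derive (f g : R -> R) y (df dg : R) : f =1 g -> df = dg ->
  is_derive y 1 f df -> is_derive y 1 g dg.
Proof. by move=> /funext -> ->. Qed.

(* As a function of the expansion point the derivative telescopes, so only the
   top-order term is left. *)
Lemma taylor_sum_is_derive (D : nat -> R -> R) (c : nat -> R) n x y :
  (forall j, (j <= n)%N -> is_derive y 1 (D j) (c j)) ->
  (forall j, (j < n)%N -> c j = D j.+1 y) ->
  is_derive y 1 (taylor_sum D n.+1 x) (c n / n`!%:R * (x - y) ^+ n).
Proof.
elim: n => [|n IH] dD cD.
  have -> : taylor_sum D 1 x = D 0%N.
    by apply/funext => t; rewrite /taylor_sum big_ord1 fact0 divr1 expr0 mulr1.
  by rewrite fact0 divr1 expr0 mulr1; exact: dD.
rewrite taylor_sumS; set T := (fun t => _).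
have h1 : is_derive y 1 (taylor_sum D n.+1 x) (D n.+1 y / n`!%:R * (x - y) ^+ n).
  by rewrite -cD//; apply: IH => [j jn|j jn]; [apply: dD; exact: leqW|apply: cD; exact: ltnW].
have hx : is_derive y 1 (fun t : R => x - t) (- 1).
  have := is_deriveB (is_derive_cst x y 1) (is_derive_id y 1); rewrite sub0r.
  by rewrite (_ : cst x - id = (fun t => x - t))//; apply/funext.
have hX : is_derive y 1 (fun t : R => (x - t) ^+ n.+1) (- (n.+1%:R * (x - y) ^+ n)).
  apply: eq_is_derive (is_deriveX n.+1 hx); first by move=> t; rewrite exprfctE.
  by rewrite -[_ *: -1]/(_ * -1) mulrN1.
have hD : is_derive y 1 (fun t => D n.+1 t / n.+1`!%:R) (c n.+1 / n.+1`!%:R).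
  have hq : is_derive y 1 (cst (n.+1`!%:R^-1) : R -> R) 0 by exact: is_derive_cst.
  apply: eq_is_derive (is_deriveM (dD n.+1 (leqnn _)) hq); first by [].
  by rewrite scaler0 add0r -[_ *: _]/(_ * _) mulrC.
have hT : is_derive y 1 T (- (D n.+1 y / n`!%:R * (x - y) ^+ n) +
    c n.+1 / n.+1`!%:R * (x - y) ^+ n.+1).
  apply: eq_is_derive (is_deriveM hD hX); first by [].
  rewrite -![_ *: _]/(_ * _) [X in _ + X]mulrC; congr (_ + _).
  have s0 : n.+1%:R != 0 :> R by rewrite pnatr_eq0.
  have q0 : n`!%:R != 0 :> R by rewrite pnatr_eq0 -lt0n fact_gt0.
  rewrite factS natrM; move: (n.+1%:R : R) s0 (n`!%:R : R) q0 => s s0 q q0; field.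
  by rewrite s0 q0.
by apply: eq_is_derive (is_deriveD h1 hT) => //; ring.
Qed.

Lemma abs_continuous_taylor_sum (D : nat -> R -> R) n x a b : a <= b ->
  (forall j, (j < n)%N -> abs_continuous a b (D j)) -> abs_continuous a b (taylor_sum D n x).
Proof.
move=> ab; elim: n => [|n IH] acD.
  apply: (@lipschitz_abs_continuous _ _ _ _ 0) => u v _ _.
  by rewrite /taylor_sum !big_ord0 subrr normr0 mul0r.
rewrite taylor_sumS; apply: abs_continuousD; first by apply: IH => j jn; apply: acD; exact: ltnW.
apply: abs_continuousM => //.
  apply: abs_continuousM => //; first exact: acD.
  by apply: (@lipschitz_abs_continuous _ _ _ _ 0) => u v _ _; rewrite subrr normr0 mul0r.
have acx : abs_continuous a b (fun t => x - t).
  apply: (@lipschitz_abs_continuous _ _ _ _ 1) => u v /andP[_ uv] _.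
  rewrite mul1r (_ : x - v - (x - u) = u - v); last by ring.
  by rewrite distrC ger0_norm ?subr_ge0.
elim: (n) => [|m IHm].
  by apply: (@lipschitz_abs_continuous _ _ _ _ 0) => u v _ _; rewrite !expr0 subrr normr0 mul0r.
apply: (@eq_abs_continuous _ _ _ ((fun t => x - t) \* (fun t => (x - t) ^+ m))).
  by move=> t _; rewrite exprS.
exact: abs_continuousM.
Qed.

(** The fundamental theorem is applied to the k-th derivative, giving [g], and to the Taylor sum,
    whose density is then recognized almost everywhere. The point [x] is free: it is [b] for the
    left derivative and [a] for the right one. *)
Lemma derive_AC_taylor a b (k : nat) f x : a < b ->
  derive_AC a b k f ->
  exists g : R -> R, [/\ leb.-integrable setT (EFin \o g),
    {ae leb, forall y, a < y < b -> f^`(k.+1)%classic y = g y} &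
    taylor_sum (fun j => derive1n_on `[a, b] j f) k.+1 x b -
    taylor_sum (fun j => derive1n_on `[a, b] j f) k.+1 x a =
    \int[leb]_(t in [set` `]a, b[]) (g t / k`!%:R * (x - t) ^+ k)].
Proof.
move=> ab [df acD]; pose D j := derive1n_on `[a, b] j f.
have [g [ig _ gD]] := abs_continuous_FTC (ltW ab) acD.
have acT : abs_continuous a b (taylor_sum D k.+1 x).
  by apply: abs_continuous_taylor_sum (ltW ab) _ => j jk; exact: (derive1n_on_abs_continuous ab df acD).
have [g1 [ig1 g1E g1D]] := abs_continuous_FTC (ltW ab) acT.
have aeF : Filter (nbhs (almost_everywhere leb)) := ae_filter_ringOfSetsType leb.
exists g; split => //.
  apply: filterS gD => y /= h /andP[ay yb]; have [dy <-] := h (introT andP (conj ay yb)).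
  rewrite !derive1E; apply: near_eq_derive.
  near=> z; rewrite (derive1n_on_itv df)//; near: z; [exact: lt_nbhsr|exact: lt_nbhsl].
rewrite -/D g1E ?lexx ?(ltW ab)// /Rintegral; congr fine.
rewrite -integral_itv_bndo_bndc; last first.
  by apply: measurable_funTS; have /integrableP[] := ig1.
apply: ae_eq_integral_nonmeasurable.
apply: filterS2 g1D gD => y /= h1 h2; rewrite in_itv/= => /andP[ay yb].
have [_ <-] := h1 (introT andP (conj ay yb)); have [dy gy] := h2 (introT andP (conj ay yb)).
(* The derivatives at [y] of the coefficients: below order [k] they are the next ones, and at order
   [k] the density. *)
pose c j := if (j < k)%N then D j.+1 y else g y.
have := @taylor_sum_is_derive D c k x y.
rewrite {3}/c ltnn => /(_ _ _)[].
- move=> j; rewrite /c leq_eqVlt => /predU1P[->|jk].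
    by rewrite ltnn -gy derive1E; exact: derivableP.
  by rewrite jk; exact: (derive1n_on_is_derive df jk ay yb).
- by move=> j jk; rewrite /c jk.
by move=> _ hd; rewrite derive1E hd.
Unshelve. all: by end_near. Qed.

End taylor.

(** * Caputo derivatives *)

Section caputo_integral.
Context {R : realType}.
Local Notation leb := (@lebesgue_measure R).
Implicit Types (a b t s mu : R) (g F h w : R -> R).

Lemma integrable_mul_bounded a b g w (M : R) : leb.-integrable setT (EFin \o g) ->
  measurable_fun [set: R] w -> (forall s, a < s < b -> `|w s| <= M) ->
  leb.-integrable [set` `]a, b[] (EFin \o (fun s => g s * w s)).
Proof.
move=> ig mw wM; have mab : measurable ([set` `]a, b[] : set (measurableTypeR R)).
  exact: measurable_itv.
have mg : measurable_fun [set: R] g by have /integrableP[/measurable_EFinP] := ig.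
have ig' : leb.-integrable [set` `]a, b[] (EFin \o g) by exact: integrableS ig.
apply: (le_integrable mab (g := fun s => (M%:E * (g s)%:E)%E)).
- by apply: measurable_funTS; apply/measurable_EFinP; exact: measurable_funM.
- move=> s; rewrite /= in_itv/= => sab; rewrite lee_fin !normrM mulrC ler_wpM2r//.
  by rewrite (le_trans (wM _ sab))// ler_norm.
- exact: integrableZl.
Qed.

(** Common form of the two sides: [u] is the outer power, [v] the kernel of the fractional integral,
    and [J t] is []a, t[] or []t, b[]. It turns the weighted integral of [h] into the double
    integral treated by [kernel_fubini]. *)
Lemma kernel_iterated_integral a b (c : R) (u : R -> R) (v K : R -> R -> R)
    (J : R -> interval R) g F h :
  c != 0 -> (forall t, a < t < b -> u t != 0) ->
  (forall t, a < t < b -> [set` J t] `<=` [set` `]a, b[]) ->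
  (forall t s, K t s = if (a < t < b) && (s \in J t) then u t * v t s else 0) ->
  {ae leb, forall y, a < y < b -> F y = g y} ->
  {ae leb, forall t, leb.-integrable setT (fun s => (c * g s * K t s)%:E)} ->
  {ae leb, forall t, a < t < b -> h t = c * \int[leb]_(s in [set` J t]) (F s * v t s)} ->
  (\int[leb]_(t in [set` `]a, b[]) (u t * h t)%:E =
   \int[leb]_t \int[leb]_s (c * g s * K t s)%:E)%E.
Proof.
move=> c0 u0 JI KE Fg iK hE.
have aeF : Filter (nbhs (almost_everywhere leb)) := ae_filter_ringOfSetsType leb.
have -> : (\int[leb]_t \int[leb]_s (c * g s * K t s)%:E =
    \int[leb]_(t in [set` `]a, b[]) \int[leb]_s (c * g s * K t s)%:E)%E.
  rewrite [RHS]integral_mkcond; apply: eq_integral => t _; rewrite patchE mem_setE in_itv/=.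
  by case: ifPn => // tab; apply: integral0_eq => s _; rewrite KE (negbTE tab) mulr0.
apply: ae_eq_integral_nonmeasurable.
apply: filterS2 iK hE => t it ht; rewrite /= in_itv/= => tab; rewrite (ht tab).
have mJ : measurable ([set` J t] : set (measurableTypeR R)) by exact: measurable_itv.
(* Integrability is known for [c * g s * K t s]; dividing by this nonzero factor gives it for
   [g s * v t s]. *)
have cu0 : c * u t != 0 by rewrite mulf_neq0// u0.
have iJ : leb.-integrable [set` J t] (EFin \o (fun s => g s * v t s)).
  have iJ' : leb.-integrable [set` J t] (fun s => (c * g s * K t s)%:E) by exact: integrableS it.
  have := integrableZl mJ (c * u t)^-1 iJ'.
  apply: eq_integrable => // s /set_mem/= sJ; rewrite KE tab sJ/= -EFinM; congr EFin.
  by rewrite (_ : c * g s * (u t * v t s) = (c * u t) * (g s * v t s)) ?mulKf//; ring.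
have -> : (\int[leb]_s (c * g s * K t s)%:E =
    \int[leb]_(s in [set` J t]) ((c * u t)%:E * (g s * v t s)%:E))%E.
  rewrite [RHS]integral_mkcond; apply: eq_integral => s _; rewrite patchE mem_setE KE tab/=.
  by case: ifPn => sJ; [rewrite -EFinM; congr EFin; ring|rewrite mulr0].
rewrite integralZl//.
have -> : (\int[leb]_(s in [set` J t]) (g s * v t s)%:E =
    (\int[leb]_(s in [set` J t]) (g s * v t s))%:E)%E.
  by rewrite /Rintegral fineK//; exact: integrable_fin_num iJ.
have -> : \int[leb]_(s in [set` J t]) (F s * v t s) = \int[leb]_(s in [set` J t]) (g s * v t s).
  rewrite /Rintegral; congr fine; apply: ae_eq_integral_nonmeasurable.
  apply: filterS Fg => s Fs sJ; rewrite Fs//.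
  by have := JI t tab _ sJ; rewrite /= in_itv.
by rewrite -EFinM; congr EFin; ring.
Qed.

Lemma ae_eq_Rintegral (D : set R) (u w : R -> R) :
  {ae leb, forall t, D t -> u t = w t} -> \int[leb]_(t in D) u t = \int[leb]_(t in D) w t.
Proof.
have aeF : Filter (nbhs (almost_everywhere leb)) := ae_filter_ringOfSetsType leb.
move=> uw; rewrite /Rintegral; congr fine; apply: ae_eq_integral_nonmeasurable.
by apply: filterS uw => t ut Dt /=; rewrite ut.
Qed.

(** The semigroup law evaluated at [b]: the orders [mu] and [rho = k.+1 - mu] add up to [k.+1],
    leaving the kernel [(b - t) ^ k / k!]. The scalar [eps] leaves room for the sign in the
    definition of Caputo derivatives. *)
Lemma fracint_left_weighted a b mu (k : nat) (eps : R) g F h :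
  a < b -> k%:R < mu <= k.+1%:R -> eps != 0 -> leb.-integrable setT (EFin \o g) ->
  {ae leb, forall y, a < y < b -> F y = g y} ->
  {ae leb, forall t, a < t < b -> h t = eps * fracint_left (k.+1%:R - mu) a F t} ->
  (Gamma mu)^-1 * \int[leb]_(t in [set` `]a, b[]) ((b - t) `^ (mu - 1) * h t) =
  eps * \int[leb]_(t in [set` `]a, b[]) (g t / k`!%:R * (b - t) ^+ k).
Proof.
move=> ab /andP[kmu muk] eps0 ig Fg hE.
have aeF : Filter (nbhs (almost_everywhere leb)) := ae_filter_ringOfSetsType leb.
have mg : measurable_fun [set: R] g by have /integrableP[/measurable_EFinP] := ig.
have mu0 : 0 < mu by rewrite (le_lt_trans _ kmu).
have G0 := Gamma_gt0 mu0.
have mab : measurable ([set` `]a, b[] : set (measurableTypeR R)) by exact: measurable_itv.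
have fact0 : k`!%:R != 0 :> R by rewrite pnatr_eq0 -lt0n fact_gt0.
have mp : measurable_fun [set: R] (fun s : R => (b - s) ^+ k).
  by apply: measurable_funX; exact: measurable_funB.
have igk : leb.-integrable [set` `]a, b[] (EFin \o (fun s => g s * (b - s) ^+ k)).
  apply: (@integrable_mul_bounded _ _ _ _ ((b - a) ^+ k)) => // s /andP[as_ sb].
  rewrite ger0_norm ?exprn_ge0 ?subr_ge0 ?(ltW sb)// lerXn2r ?nnegrE ?subr_ge0 ?(ltW ab) ?(ltW sb)//.
  by rewrite lerD2l lerN2 ltW.
have -> : \int[leb]_(t in [set` `]a, b[]) (g t / k`!%:R * (b - t) ^+ k) =
    k`!%:R^-1 * \int[leb]_(t in [set` `]a, b[]) (g t * (b - t) ^+ k).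
  by rewrite -RintegralZl//; apply: eq_Rintegral => t _; rewrite mulrA [_^-1 * _]mulrC.
have powk (s : R) : a < s < b -> (b - s) `^ k%:R = (b - s) ^+ k.
  by move=> /andP[_ sb]; rewrite powR_mulrn// subr_ge0 ltW.
(* When [mu] is the integer [k.+1], the fractional integral is the identity by definition, and the
   claim holds under the integral almost everywhere. *)
have [rho0|rho0] := eqVneq (k.+1%:R - mu) 0.
  have muE : mu = k.+1%:R by apply/eqP; rewrite eq_sym -subr_eq0 rho0.
  rewrite muE Gamma_nat (_ : k.+1%:R - 1 = k%:R :> R); last by rewrite -natr1 addrK.
  rewrite (ae_eq_Rintegral (w := fun t => eps * (g t * (b - t) ^+ k))).
    by rewrite RintegralZl//; ring.
  apply: filterS2 hE Fg => t ht Ft; rewrite /= in_itv/= => tab.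
  by rewrite ht// /fracint_left rho0 eqxx Ft// powk//; ring.
have rho_gt0 : 0 < k.+1%:R - mu by rewrite lt_neqAle eq_sym rho0 subr_ge0.
set rho := k.+1%:R - mu in rho0 rho_gt0 hE *.
have Gr0 := Gamma_gt0 rho_gt0.
pose c := eps * (Gamma rho)^-1.
have c0 : c != 0 by rewrite mulf_neq0// invr_neq0// gt_eqF.
have pq : mu + rho - 1 = k%:R by rewrite /rho -natr1; ring.
have mcg : measurable_fun [set: R] (fun s => c * g s) by exact: measurable_funM.
have icg : leb.-integrable [set` `]a, b[] (EFin \o (fun s => c * g s * (b - s) `^ (mu + rho - 1))).
  have := integrableZl mab c igk; apply: eq_integrable => // s /set_mem/=.
  by rewrite in_itv/= => sab; rewrite pq powk// -EFinM mulrA.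
have [iK KE] := left_kernel_fubini mu0 rho_gt0 mcg icg.
have := @kernel_iterated_integral a b c (fun t => (b - t) `^ (mu - 1))
  (fun t s => ((t - s) `^ (1 - rho))^-1) (left_kernel mu rho a b) (fun t => `]a, t[) g F h.
rewrite KE => /(_ c0) hK.
have {}hK : (\int[leb]_(t in [set` `]a, b[]) ((b - t) `^ (mu - 1) * h t)%:E =
  (Gamma mu * Gamma rho / Gamma (mu + rho))%:E *
  \int[leb]_(s in [set` `]a, b[]) (c * g s * (b - s) `^ (mu + rho - 1))%:E)%E.
  apply: hK => //.
  - by move=> t /andP[_ tb]; rewrite gt_eqF// powR_gt0// subr_gt0.
  - by move=> t /andP[_ tb] s; rewrite /= !in_itv/= => /andP[-> st]; rewrite (lt_trans st).
  - move=> t s; rewrite /left_kernel /beta_integrand in_itv/=.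
    have -> : (a < t < b) && (a < s < t) = (a < s) && (s < t) && (t < b).
      apply/idP/idP => [/andP[/andP[_ ->] ->]//|/andP[/andP[as_ st] ->]].
      by rewrite as_ st (lt_trans as_ st).
    by case: ifP => // _; rewrite mulrC -powRN opprB.
  - apply: filterS hE => t ht tab.
    by rewrite ht// /fracint_left (negbTE rho0) /c mulrA.
have -> : \int[leb]_(t in [set` `]a, b[]) ((b - t) `^ (mu - 1) * h t) =
    Gamma mu * Gamma rho / Gamma (mu + rho) *
    \int[leb]_(s in [set` `]a, b[]) (c * g s * (b - s) `^ (mu + rho - 1)).
  by rewrite /Rintegral hK fineM//; exact: integrable_fin_num icg.
have -> : \int[leb]_(s in [set` `]a, b[]) (c * g s * (b - s) `^ (mu + rho - 1)) =
    c * \int[leb]_(s in [set` `]a, b[]) (g s * (b - s) ^+ k).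
  rewrite -RintegralZl//; apply: eq_Rintegral => s /set_mem/=.
  by rewrite in_itv/= => sab; rewrite pq powk// mulrA.
(* The Beta factor has denominator [k!], while [Gamma mu] and [Gamma rho] cancel against the
   normalizations. *)
rewrite (_ : mu + rho = k.+1%:R) ?Gamma_nat; last by rewrite /rho; ring.
rewrite /c; move: (Rintegral _ _ _) => X; field.
by rewrite fact0 !gt_eqF.
Qed.

Lemma fracint_right_weighted a b mu (k : nat) (eps : R) g F h :
  a < b -> k%:R < mu <= k.+1%:R -> eps != 0 -> leb.-integrable setT (EFin \o g) ->
  {ae leb, forall y, a < y < b -> F y = g y} ->
  {ae leb, forall t, a < t < b -> h t = eps * fracint_right (k.+1%:R - mu) b F t} ->
  (Gamma mu)^-1 * \int[leb]_(t in [set` `]a, b[]) ((t - a) `^ (mu - 1) * h t) =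
  eps * \int[leb]_(t in [set` `]a, b[]) (g t / k`!%:R * (t - a) ^+ k).
Proof.
move=> ab /andP[kmu muk] eps0 ig Fg hE.
have aeF : Filter (nbhs (almost_everywhere leb)) := ae_filter_ringOfSetsType leb.
have mg : measurable_fun [set: R] g by have /integrableP[/measurable_EFinP] := ig.
have mu0 : 0 < mu by rewrite (le_lt_trans _ kmu).
have G0 := Gamma_gt0 mu0.
have mab : measurable ([set` `]a, b[] : set (measurableTypeR R)) by exact: measurable_itv.
have fact0 : k`!%:R != 0 :> R by rewrite pnatr_eq0 -lt0n fact_gt0.
have mp : measurable_fun [set: R] (fun s : R => (s - a) ^+ k).
  by apply: measurable_funX; exact: measurable_funB.
have igk : leb.-integrable [set` `]a, b[] (EFin \o (fun s => g s * (s - a) ^+ k)).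
  apply: (@integrable_mul_bounded _ _ _ _ ((b - a) ^+ k)) => // s /andP[as_ sb].
  rewrite ger0_norm ?exprn_ge0 ?subr_ge0 ?(ltW as_)// lerXn2r ?nnegrE ?subr_ge0 ?(ltW ab) ?(ltW as_)//.
  by rewrite lerD2r ltW.
have -> : \int[leb]_(t in [set` `]a, b[]) (g t / k`!%:R * (t - a) ^+ k) =
    k`!%:R^-1 * \int[leb]_(t in [set` `]a, b[]) (g t * (t - a) ^+ k).
  by rewrite -RintegralZl//; apply: eq_Rintegral => t _; rewrite mulrA [_^-1 * _]mulrC.
have powk (s : R) : a < s < b -> (s - a) `^ k%:R = (s - a) ^+ k.
  by move=> /andP[as_ _]; rewrite powR_mulrn// subr_ge0 ltW.
have [rho0|rho0] := eqVneq (k.+1%:R - mu) 0.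
  have muE : mu = k.+1%:R by apply/eqP; rewrite eq_sym -subr_eq0 rho0.
  rewrite muE Gamma_nat (_ : k.+1%:R - 1 = k%:R :> R); last by rewrite -natr1 addrK.
  rewrite (ae_eq_Rintegral (w := fun t => eps * (g t * (t - a) ^+ k))).
    by rewrite RintegralZl//; ring.
  apply: filterS2 hE Fg => t ht Ft; rewrite /= in_itv/= => tab.
  by rewrite ht// /fracint_right rho0 eqxx Ft// powk//; ring.
have rho_gt0 : 0 < k.+1%:R - mu by rewrite lt_neqAle eq_sym rho0 subr_ge0.
set rho := k.+1%:R - mu in rho0 rho_gt0 hE *.
have Gr0 := Gamma_gt0 rho_gt0.
pose c := eps * (Gamma rho)^-1.
have c0 : c != 0 by rewrite mulf_neq0// invr_neq0// gt_eqF.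
have pq : mu + rho - 1 = k%:R by rewrite /rho -natr1; ring.
have mcg : measurable_fun [set: R] (fun s => c * g s) by exact: measurable_funM.
have icg : leb.-integrable [set` `]a, b[] (EFin \o (fun s => c * g s * (s - a) `^ (mu + rho - 1))).
  have := integrableZl mab c igk; apply: eq_integrable => // s /set_mem/=.
  by rewrite in_itv/= => sab; rewrite pq powk// -EFinM mulrA.
have [iK KE] := right_kernel_fubini mu0 rho_gt0 mcg icg.
have := @kernel_iterated_integral a b c (fun t => (t - a) `^ (mu - 1))
  (fun t s => ((s - t) `^ (1 - rho))^-1) (right_kernel mu rho a b) (fun t => `]t, b[) g F h.
rewrite KE => /(_ c0) hK.
have {}hK : (\int[leb]_(t in [set` `]a, b[]) ((t - a) `^ (mu - 1) * h t)%:E =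
  (Gamma mu * Gamma rho / Gamma (mu + rho))%:E *
  \int[leb]_(s in [set` `]a, b[]) (c * g s * (s - a) `^ (mu + rho - 1))%:E)%E.
  apply: hK => //.
  - by move=> t /andP[at_ _]; rewrite gt_eqF// powR_gt0// subr_gt0.
  - by move=> t /andP[at_ _] s; rewrite /= !in_itv/= => /andP[ts ->]; rewrite (lt_trans at_).
  - move=> t s; rewrite /right_kernel /beta_integrand in_itv/=.
    have -> : (a < t < b) && (t < s < b) = (a < t) && (t < s) && (s < b).
      apply/idP/idP => [/andP[/andP[-> _] /andP[-> ->]]//|/andP[/andP[-> ts] sb]].
      by rewrite ts sb (lt_trans ts sb).
    by case: ifP => // _; rewrite -powRN opprB.
  - apply: filterS hE => t ht tab.
    by rewrite ht// /fracint_right (negbTE rho0) /c mulrA.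
have -> : \int[leb]_(t in [set` `]a, b[]) ((t - a) `^ (mu - 1) * h t) =
    Gamma mu * Gamma rho / Gamma (mu + rho) *
    \int[leb]_(s in [set` `]a, b[]) (c * g s * (s - a) `^ (mu + rho - 1)).
  by rewrite /Rintegral hK fineM//; exact: integrable_fin_num icg.
have -> : \int[leb]_(s in [set` `]a, b[]) (c * g s * (s - a) `^ (mu + rho - 1)) =
    c * \int[leb]_(s in [set` `]a, b[]) (g s * (s - a) ^+ k).
  rewrite -RintegralZl//; apply: eq_Rintegral => s /set_mem/=.
  by rewrite in_itv/= => sab; rewrite pq powk// mulrA.
rewrite (_ : mu + rho = k.+1%:R) ?Gamma_nat; last by rewrite /rho; ring.
rewrite /c; move: (Rintegral _ _ _) => X; field.
by rewrite fact0 !gt_eqF.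
Qed.

End caputo_integral.

Theorem theorem1 (R : realType) (k : nat) (mu theta : R) (f : R -> R)
    (hk : (1 <= k)%N) (hmu : k%:R - 1 < mu <= k%:R)
    (hf : n_derivable_at k.-1 f theta) :
  (forall (x : R) (h : R -> R), theta < x ->
     derive_AC theta x k.-1 f ->
     bounded_variation theta x h ->
     caputo_left k mu theta f = h %[ae (@lebesgue_measure R) in `[theta, x]%classic] ->
     f x = \sum_(j < k) (f^`(j)%classic) theta / (j`!)%:R * (x - theta) ^+ j
           + lim (h @ theta^'+) / Gamma (mu + 1) * (x - theta) `^ mu
           + (Gamma (mu + 1))^-1
             * RS_integral_open theta x (fun t : R => (x - t) `^ mu) h)
  /\
  (forall (x : R) (h : R -> R), x < theta ->
     derive_AC x theta k.-1 f ->
     bounded_variation x theta h ->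
     caputo_right k mu theta f = h %[ae (@lebesgue_measure R) in `[x, theta]%classic] ->
     f x = \sum_(j < k) (f^`(j)%classic) theta / (j`!)%:R * (x - theta) ^+ j
           + lim (h @ theta^'-) / Gamma (mu + 1) * (theta - x) `^ mu
           - (Gamma (mu + 1))^-1
             * RS_integral_open x theta (fun t : R => (t - x) `^ mu) h).
Proof.
have aeF : Filter (nbhs (almost_everywhere (@lebesgue_measure R))) :=
  ae_filter_ringOfSetsType (@lebesgue_measure R).
(* From here on [k] is the former [k.-1]: the order of the top derivative reads [k.+1]. *)
case: k hk hmu hf => // k _; rewrite -[in X in X -> _]natr1 addrK => hmu.
have {}hmu : k%:R < mu <= k.+1%:R by rewrite -natr1.
rewrite [_.-1]/= => hf.
have mu0 : 0 < mu by case/andP: hmu => kmu _; rewrite (le_lt_trans _ kmu).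
have G0 := Gamma_gt0 mu0; rewrite GammaS//.
have mun0 : mu != 0 by rewrite gt_eqF.
have Gn0 : Gamma mu != 0 by rewrite gt_eqF.
split => x h xt dAC bv hE.
- rewrite (RS_integral_open_left mu0 xt bv).
  have [g [ig Fg tE]] := derive_AC_taylor x xt dAC.
  have hE' : {ae (@lebesgue_measure R), forall t, theta < t < x ->
      h t = 1 * fracint_left (k.+1%:R - mu) theta (f^`(k.+1)%classic) t}.
    apply: filterS hE => t ht /andP[at_ tb]; rewrite mul1r -ht//.
    by rewrite /= in_itv/= !ltW.
  have := fracint_left_weighted xt hmu (oner_neq0 R) ig Fg hE'; rewrite mul1r -tE.
  rewrite taylor_sum_center => /eqP; rewrite eq_sym subr_eq => /eqP.
  rewrite [derive1n_on _ 0 f x]/= => ->.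
  have -> : taylor_sum (fun j => derive1n_on `[theta, x] j f) k.+1 x theta =
      \sum_(j < k.+1) (f^`(j)%classic) theta / (j`!)%:R * (x - theta) ^+ j.
    apply: eq_bigr => j _; rewrite (derive1n_on_left xt dAC.1)//.
    by rewrite -ltnS.
  (* The limit term cancels against the boundary term of the integration by parts, and [mu] against
     the factor in Gamma(mu + 1) = mu Gamma(mu). *)
  move: (Rintegral _ _ _) (\sum_(j < _) _) (lim _) => X S L.
  by field; rewrite mun0 Gn0.
- rewrite (RS_integral_open_right mu0 xt bv).
  have [g [ig Fg tE]] := derive_AC_taylor x xt dAC.
  have e0 : (- 1) ^+ k.+1 != 0 :> R by rewrite signr_eq0.
  have hE' : {ae (@lebesgue_measure R), forall t, x < t < theta ->
      h t = (- 1) ^+ k.+1 * fracint_right (k.+1%:R - mu) theta (f^`(k.+1)%classic) t}.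
    apply: filterS hE => t ht /andP[at_ tb]; rewrite -ht//.
    by rewrite /= in_itv/= !ltW.
  have := fracint_right_weighted xt hmu e0 ig Fg hE'.
  (* Here [x] is the left end, so the Taylor increment is the value at [theta] minus [f x]. The
     Caputo sign turns [(t - x) ^ k] into [- (x - t) ^ k], which matches this orientation. *)
  have -> : (- 1) ^+ k.+1 * \int[lebesgue_measure]_(t in [set` `]x, theta[])
      (g t / k`!%:R * (t - x) ^+ k) =
      - \int[lebesgue_measure]_(t in [set` `]x, theta[]) (g t / k`!%:R * (x - t) ^+ k).
    rewrite exprS -mulrA mulN1r -RintegralZl//; last first.
      have mX : measurable_fun [set: R] (fun t : R => k`!%:R^-1 * (t - x) ^+ k).
        by apply: measurable_funM => //; apply: measurable_funX; exact: measurable_funB.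
      have : lebesgue_measure.-integrable [set` `]x, theta[]
          (EFin \o (fun t => g t * (k`!%:R^-1 * (t - x) ^+ k))).
        apply: (@integrable_mul_bounded _ _ _ _ _ (k`!%:R^-1 * (theta - x) ^+ k)) => // s.
        move=> /andP[xs st]; rewrite normrM ger0_norm ?invr_ge0// ler_wpM2l ?invr_ge0//.
        rewrite ger0_norm ?exprn_ge0 ?subr_ge0 ?(ltW xs)//.
        by rewrite lerXn2r ?nnegrE ?subr_ge0 ?(ltW xs) ?(ltW xt)// lerD2r ltW.
      by apply: eq_integrable; [exact: measurable_itv|move=> t _ /=; rewrite mulrA].
    congr (- _); apply: eq_Rintegral => t _.
    by rewrite -[x - t]opprB [(- (t - x)) ^+ _]exprNn mulrCA.
  rewrite -tE taylor_sum_center [derive1n_on _ 0 f x]/= opprB => /eqP.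
  rewrite eq_sym subr_eq => /eqP ->.
  have -> : taylor_sum (fun j => derive1n_on `[x, theta] j f) k.+1 x theta =
      \sum_(j < k.+1) (f^`(j)%classic) theta / (j`!)%:R * (x - theta) ^+ j.
    apply: eq_bigr => j _; rewrite (derive1n_on_right xt dAC.1)//.
    by rewrite -ltnS.
  move: (Rintegral _ _ _) (\sum_(j < _) _) (lim _) => X S L.
  by field; rewrite mun0 Gn0.
Qed.
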